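(* Let $n\in\mathbb{N}$ (with $n\ge1$), $a>1$, $\lambda>0$, and put $z_j=-i\left(1-\frac{2j}{n}\right)$ for $0\le j\le n$. Let $$F_n(z,a)=\sum_{j=0}^n C_j(n,a)\,e^{i(1-2j/n)z},\qquad C_j(n,a)=\binom{n}{j}\left(\frac{1+a}{2}\right)^{n-j}\left(\frac{1-a}{2}\right)^j .$$ For $w_0,\dots,w_n\in\mathbb{C}$ consider on the Fock space $\mathcal{F}(\mathbb{C})$ the functional $$J(f)=\sum_{k=0}^n|w_k-f(z_k)|^2+\lambda\|f\|^2 .$$ Then $F_n(\cdot,a)$ is the minimizer of $J$ over $\mathcal{F}(\mathbb{C})$ if and only if, for all $0\le k\le n$, $$w_k=\left[\frac{1+a}{2}\right]^n\left[e^{1-\frac{2k}{n}}\left(1+\frac{1-a}{1+a}\,e^{-\frac2n+\frac{4k}{n^2}}\right)^n+\lambda\binom{n}{k}\left(\frac{1-a}{1+a}\right)^k\right].$$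
   Context: The Fock space $\mathcal{F}(\mathbb{C})$ is the Hilbert space of entire functions $f$ with $\|f\|^2=\frac1\pi\int_{\mathbb{C}}|f(z)|^2e^{-|z|^2}\,dA(z)<\infty$, where $dA=dx\,dy$. Its reproducing kernel is $B(z,w)=e^{z\overline{w}}$, so that $F_n(z,a)=\sum_{j=0}^n C_j(n,a)B(z,z_j)$. *)

(* Defs.v *)
From HB Require Import structures.
From mathcomp Require Import all_boot all_order all_algebra.
From mathcomp Require Import all_classical all_reals all_analysis.
From mathcomp Require Export complex.

Set Implicit Arguments.
Unset Strict Implicit.
Unset Printing Implicit Defensive.

Import Order.TTheory GRing.Theory Num.Theory.
Import numFieldNormedType.Exports.
Import ComplexField.Normc.

Local Open Scope classical_set_scope.
Local Open Scope ring_scope.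
Local Open Scope complex_scope.

Definition expC (R : realType) (z : R[i]) : R[i] :=
  (expR (complex.Re z) * cos (complex.Im z)) +i* (expR (complex.Re z) * sin (complex.Im z)).

(* The scalar field of [R[i]^o] is [R[i]] itself, so derivability in the
   direction [1] is complex differentiability. *)
Definition entire (R : realType) (f : R[i] -> R[i]) : Prop :=
  forall z : R[i], derivable (f : R[i]^o -> R[i]^o) z 1.

(* The plane is [R * R] with the product Lebesgue measure. The value is extended
   real: it is [+oo] when the integral diverges. *)
Definition fock_sqnorm (R : realType) (f : R[i] -> R[i]) : \bar R :=
  ((pi^-1)%:E *
   \int[lebesgue_measure \x lebesgue_measure]_(p in [set: R * R])
     (normc (f (p.1 +i* p.2)) ^+ 2 * expR (- normc (p.1 +i* p.2) ^+ 2))%:E)%E.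

Definition fock (R : realType) : set (R[i] -> R[i]) :=
  [set f | entire f /\ (fock_sqnorm f < +oo)%E].

Definition node (R : realType) (n j : nat) : R[i] :=
  - ('i%C * (1 - 2 * j%:R / n%:R)%:C).

Definition coefF (R : realType) (n : nat) (a : R) (j : nat) : R :=
  'C(n, j)%:R * ((1 + a) / 2) ^+ (n - j) * ((1 - a) / 2) ^+ j.

Definition superosc (R : realType) (n : nat) (a : R) (z : R[i]) : R[i] :=
  \sum_(j < n.+1) (coefF n a j)%:C * expC ('i%C * (1 - 2 * j%:R / n%:R)%:C * z).

Definition functional_J (R : realType) (n : nat) (lambda : R)
    (w : 'I_n.+1 -> R[i]) (f : R[i] -> R[i]) : \bar R :=
  ((\sum_(k < n.+1) normc (w k - f (node R n k)) ^+ 2)%:E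
   + lambda%:E * fock_sqnorm f)%E.

Definition is_minimizer (R : realType) (T : Type) (A : set T) (J : T -> \bar R)
    (x : T) : Prop :=
  A x /\ forall y, A y -> (J x <= J y)%E.

(* Main.v *)
Require Import Defs.
From HB Require Import structures.
From mathcomp Require Import all_boot all_order all_algebra.
From mathcomp Require Import all_classical all_reals all_analysis.
From mathcomp Require Import complex.
From mathcomp Require Import measurable_realfun.
From mathcomp Require Import ring lra.

Set Implicit Arguments.
Unset Strict Implicit.
Unset Printing Implicit Defensive.

Import Order.TTheory GRing.Theory Num.Theory.
Import numFieldNormedType.Exports.
Import ComplexField.Normc.

Local Open Scope classical_set_scope.
Local Open Scope ring_scope.
Local Open Scope complex_scope.

(** The functional [J] is a strictly convex quadratic function on the Fock space,
    so [F] minimizes it exactly when the derivative of [J] at [F] vanishes in every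
    direction [h].  Since [F] is a combination of reproducing kernels with real
    coefficients [C_k], the inner product of [h] with [F] is the sum of the
    [C_k h(z_k)], and half the derivative is the real part of the sum of
    [h(z_k) d_k], where [d_k] is the conjugate of [lambda C_k - (w_k - F(z_k))]
    ([real_J_expand]).  Taking for [h] a Lagrange polynomial at the nodes
    isolates each [d_k], so the derivative vanishes iff
    [w_k = F(z_k) + lambda C_k] for all [k]; the binomial theorem puts
    [F(z_k)] in closed form.  Strict convexity, i.e. [||h|| = 0 -> h = 0], makes
    the minimizer unique.

    The analytic core is the reproducing property [reproducing], for functions
    only assumed complex differentiable at every point.  Translating the plane
    by [w] and completing the square turns it into the Gaussian mean value
    property [gaussian_mean_value]: the integral of [g(u) exp(-|u|^2)] is
    [pi g(0)] for [g] entire.  Lebesgue measure and the Gaussian weight are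
    invariant under rotations, which are products of shears, so [g] may be
    replaced by its mean over circles; this avoids polar coordinates.  The mean
    of [g] over a circle is [g(0)] ([circle_mean_value]), because in the
    coordinate [zeta] with [u = exp(zeta) z] it is the integral along a vertical
    period segment, which Goursat's theorem on squares of side [2 pi]
    ([square_circulation_eq0]) allows to be moved towards [-oo].

    Only real parts of inner products and imaginary parts of contour integrals
    enter, so that all integrals below are integrals of real functions. *)

(** * Complex differentiability and the exponential *)

Lemma normc_sqr (R : realType) (z : R[i]) :
  normc z ^+ 2 = complex.Re z ^+ 2 + complex.Im z ^+ 2.
Proof. by case: z => x y /=; rewrite sqr_sqrtr // addr_ge0 // sqr_ge0. Qed.

Lemma normc_ge0 (R : realType) (z : R[i]) : 0 <= normc z.
Proof. by case: z => x y /=; exact: sqrtr_ge0. Qed.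

Lemma normr_Re_le (R : realType) (z : R[i]) : `|complex.Re z| <= normc z.
Proof.
rewrite -(@ler_pXn2r _ 2) ?nnegrE ?normc_ge0 //.
by rewrite real_normK ?num_real // normc_sqr lerDl sqr_ge0.
Qed.

Lemma normr_Im_le (R : realType) (z : R[i]) : `|complex.Im z| <= normc z.
Proof.
rewrite -(@ler_pXn2r _ 2) ?nnegrE ?normc_ge0 //.
by rewrite real_normK ?num_real // normc_sqr lerDr sqr_ge0.
Qed.

Lemma normc_le (R : realType) (x y : R) : normc (x +i* y) <= `|x| + `|y|.
Proof.
rewrite -(@ler_pXn2r _ 2) ?nnegrE ?normc_ge0 ?addr_ge0 //.
rewrite normc_sqr /= -(real_normK (num_real x)) -(real_normK (num_real y)).
have := normr_ge0 x; have := normr_ge0 y; nra.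
Qed.

Lemma normc_normr (R : realType) (z : R[i]) : `|z| = (normc z)%:C.
Proof. by rewrite normc_def; case: z. Qed.

(** Complex differentiability in remainder form with real tolerances, the shape
    in which the bisection argument for Goursat's theorem consumes it. *)
Definition cderiv_at (R : realType) (f : R[i] -> R[i]) (z l : R[i]) : Prop :=
  forall eps : R, 0 < eps -> exists2 d : R, 0 < d &
    forall h, normc h < d -> normc (f (z + h) - f z - l * h) <= eps * normc h.

Lemma derivable_cderiv_at (R : realType) (f : R[i] -> R[i]) (z : R[i]) :
  derivable (f : R[i]^o -> R[i]^o) z 1 -> exists l, cderiv_at f z l.
Proof.
move=> /cvg_ex[/= l fl]; exists l => eps e0.
have e0' : 0 < eps%:C :> R[i] by rewrite ltcR.
move/cvgrPdist_le : fl => /(_ _ e0').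
move=> -[d /= d0 fd].
have dR : d = (complex.Re d)%:C.
  by rewrite RRe_real // realE ltW.
exists (complex.Re d); first by rewrite -ltcR -dR.
move=> h hd; have [->|h0] := eqVneq h 0.
  by rewrite addr0 subrr mulr0 subrr normc0 mulr0.
have hn0 : 0 < normc h.
  by rewrite lt_def normc_ge0 andbT; apply: contra h0 => /eqP/eq0_normc->.
have /= := fd h; rewrite sub0r normrN normc_normr dR ltcR => /(_ hd h0).
rewrite normc_normr lecR => H.
have -> : f (z + h) - f z - l * h = - ((l - h^-1 *: (f (h *: 1 + z) - f z)) * h).
  rewrite /GRing.scale /= mulr1 (addrC h) mulrBl opprB; congr (_ - _).
  by rewrite mulrAC mulVf // mul1r.
rewrite normcN normcM ler_wpM2r //; exact: ltW.
Qed.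

Lemma cderiv_at_derivable (R : realType) (f : R[i] -> R[i]) (z l : R[i]) :
  cderiv_at f z l -> derivable (f : R[i]^o -> R[i]^o) z 1.
Proof.
move=> fl; apply/cvg_ex; exists l; apply/cvgrPdist_le => eps e0.
have eR : eps = (complex.Re eps)%:C by rewrite RRe_real // realE ltW.
have [|d d0 fd] := fl (complex.Re eps); first by rewrite -ltcR -eR.
exists d%:C; first by rewrite /= ltcR.
move=> h /=; rewrite sub0r normrN normc_normr ltcR => /fd hd h0.
have hn0 : 0 < normc h.
  by rewrite lt_def normc_ge0 andbT; apply: contra h0 => /eqP/eq0_normc->.
rewrite eR normc_normr lecR -(ler_pM2r hn0) -normcM.
suff -> : (l - h^-1 *: (f (h *: 1 + z) - f z)) * h = - (f (z + h) - f z - l * h).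
  by rewrite normcN.
rewrite /GRing.scale /= mulr1 (addrC h) mulrBl opprB; congr (_ - _).
by rewrite mulrAC mulVf // mul1r.
Qed.

(** The real counterpart of [cderiv_at]; it supplies the remainders of exp, cos
    and sin at 0 to [expC_cderiv0]. *)
Lemma is_derive_remainder (R : realType) (f : R -> R) (x l : R) :
  is_derive x 1 f l -> forall eps, 0 < eps -> exists2 d : R, 0 < d &
    forall h, `|h| < d -> `|f (x + h) - f x - l * h| <= eps * `|h|.
Proof.
move=> [df fl] eps e0; move: df => /cvg_ex[/= l' fl'].
have ll' : l' = l by rewrite -fl; apply/esym/cvg_lim.
move: fl'; rewrite ll' => {ll'} /cvgrPdist_le /(_ _ e0).
move=> -[d /= d0 fd].
exists d => // h hd; have [->|h0] := eqVneq h 0.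
  by rewrite addr0 subrr mulr0 subrr normr0 mulr0.
have /= := fd h; rewrite sub0r normrN => /(_ hd h0) H.
have -> : f (x + h) - f x - l * h = - ((l - h^-1 *: (f (h *: 1 + x) - f x)) * h).
  rewrite /GRing.scale /= mulr1 (addrC h) mulrBl opprB; congr (_ - _).
  by rewrite mulrAC mulVf // mul1r.
by rewrite normrN normrM ler_wpM2r.
Qed.

Lemma expCD (R : realType) (z w : R[i]) : expC (z + w) = expC z * expC w.
Proof.
case: z w => [a b] [c d]; rewrite /expC /= expRD cosD sinD.
by apply/eqP; rewrite eq_complex /=; apply/andP; split; apply/eqP; ring.
Qed.

Lemma expC0 (R : realType) : expC (0 : R[i]) = 1.
Proof. by rewrite /expC /= expR0 cos0 sin0 !mul1r. Qed.

Lemma normc_expC (R : realType) (z : R[i]) : normc (expC z) = expR (complex.Re z).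
Proof.
case: z => x y; rewrite /expC /=.
rewrite !exprMn -mulrDr cos2Dsin2 mulr1 sqrtr_sqr ger0_norm //.
Qed.

(** With [A = e^x - 1 - x], [B = cos y - 1] and [S = sin y - y], the real and
    imaginary parts of the remainder are [A + (1 + x + A) B] and
    [S + (x + A) (y + S)], sums of terms that are small compared with [|x + iy|]. *)
Lemma expC_cderiv0 (R : realType) : cderiv_at (@expC R) 0 1.
Proof.
move=> eps e0.
(* The four remainder terms below add up to [9 * m * N], with [N] the norm of [h]. *)
have [m [m0 m1 me]] : exists m : R, [/\ 0 < m, m <= 1 & 9 * m <= eps].
  exists (Num.min (eps / 9) 1); split.
  - by rewrite lt_min divr_gt0 //=.
  - by rewrite ge_min lexx orbT.
  - by rewrite mulrC -ler_pdivlMr // ge_min lexx.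
have [d1 d10 H1] := is_derive_remainder (@is_derive_expR R 0) m0.
have [d2 d20 H2] := is_derive_remainder (@is_derive_cos R 0) m0.
have [d3 d30 H3] := is_derive_remainder (@is_derive_sin R 0) m0.
exists (Num.min (Num.min d1 d2) (Num.min d3 m)).
  by rewrite !lt_min d10 d20 d30 m0.
case=> x y; rewrite !lt_min => /andP[/andP[hd1 hd2] /andP[hd3 /ltW hm]].
have xN : `|x| <= normc (x +i* y) by exact: (normr_Re_le (x +i* y)).
have yN : `|y| <= normc (x +i* y) by exact: (normr_Im_le (x +i* y)).
have N0 := normc_ge0 (x +i* y).
move: (normc _ : R) hd1 hd2 hd3 hm xN yN N0 => N hd1 hd2 hd3 hm xN yN N0.
have := H1 x (le_lt_trans xN hd1); rewrite add0r expR0 mul1r.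
have := H2 y (le_lt_trans yN hd2); rewrite add0r cos0 sin0 oppr0 mul0r subr0.
have := H3 y (le_lt_trans yN hd3); rewrite add0r sin0 cos0 mul1r subr0.
set A := expR x - 1 - x; set B := cos y - 1; set S := sin y - y => HS HB HA.
rewrite add0r expC0 mul1r.
apply: (le_trans (normc_le (expR x * cos y - 1 - x) (expR x * sin y - 0 - y))).
have -> : expR x * cos y - 1 - x = A + (1 + x + A) * B by rewrite /A /B; ring.
have -> : expR x * sin y - 0 - y = S + (x + A) * (y + S) by rewrite /A /S; ring.
have le1 (t : R) : `|t| <= N -> m * `|t| <= m * N by move=> ?; rewrite ler_pM2l.
move: (le_trans HA (le1 _ xN)) (le_trans HB (le1 _ yN)) (le_trans HS (le1 _ yN)).
move: A B S {HA HB HS} => A B S HA HB HS.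
have N1 : N <= 1 by apply: le_trans hm m1.
have mN : m * N <= N by rewrite ler_piMl.
have NN : N * N <= m * N by rewrite ler_wpM2r.
have L1 : `|1 + x + A| <= 3.
  apply: le_trans (ler_normD _ _) _; have := ler_normD 1 x; rewrite normr1; lra.
have L2 : `|x + A| <= 2 * N by apply: le_trans (ler_normD _ _) _; lra.
have L3 : `|y + S| <= 2 * N by apply: le_trans (ler_normD _ _) _; lra.
have L4 : `|(1 + x + A) * B| <= 3 * (m * N) by rewrite normrM ler_pM.
have L5 : `|(x + A) * (y + S)| <= (2 * N) * (2 * N) by rewrite normrM ler_pM.
have := ler_normD A ((1 + x + A) * B); have := ler_normD S ((x + A) * (y + S)).
have : 9 * m * N <= eps * N by rewrite ler_wpM2r.
lra.
Qed.

(** The addition formula moves the estimate at the origin to [z]. *)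
Lemma expC_derivable (R : realType) (z : R[i]) :
  derivable (@expC R : R[i]^o -> R[i]^o) z 1.
Proof.
apply: (@cderiv_at_derivable _ _ _ (expC z)) => eps e0.
have ez0 := expR_gt0 (complex.Re z).
have [|d d0 fd] := @expC_cderiv0 R (eps / expR (complex.Re z)); first by rewrite divr_gt0.
exists d => // h /fd; rewrite add0r expC0 mul1r expCD => hd.
have -> : expC z * expC h - expC z - expC z * h = expC z * (expC h - 1 - h) by ring.
by rewrite normcM normc_expC mulrC -ler_pdivlMr // mulrAC.
Qed.

Section entire_closure.
Variable R : realType.
Implicit Types f g : R[i] -> R[i].

Lemma entireE f : entire f <-> forall z, differentiable (f : R[i]^o -> R[i]^o) z.
Proof. by split=> fz z; apply/derivable1_diffP; exact: fz. Qed.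

Lemma entire_expC : entire (@expC R).
Proof. exact: expC_derivable. Qed.

Lemma entire_cst (c : R[i]) : entire (fun=> c).
Proof. by move=> z; exact: (@derivable_cst _ R[i]^o R[i]^o). Qed.

Lemma entire_id : entire (fun z : R[i] => z).
Proof. by move=> z; exact: (@derivable_id _ R[i]^o). Qed.

Lemma entireD f g : entire f -> entire g -> entire (fun z => f z + g z).
Proof. by move=> fe ge z; exact: (@derivableD _ R[i]^o R[i]^o f g). Qed.

Lemma entireM f g : entire f -> entire g -> entire (fun z => f z * g z).
Proof. by move=> fe ge z; exact: (@derivableM _ R[i]^o f g). Qed.

Lemma entire_comp f g : entire f -> entire g -> entire (fun z => f (g z)).
Proof.
move=> /entireE fe /entireE ge; apply/entireE => z.
exact: (@differentiable_comp _ R[i]^o R[i]^o R[i]^o g f).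
Qed.

Lemma entire_prod (I : Type) (r : seq I) (P : pred I) (F : I -> R[i] -> R[i]) :
  (forall i, entire (F i)) -> entire (fun z => \prod_(i <- r | P i) F i z).
Proof.
move=> Fe; elim: r => [|i r IH].
  rewrite (_ : (fun _ => _) = fun=> 1); first exact: entire_cst.
  by apply/funext => z; rewrite big_nil.
have [Pi|Pi] := boolP (P i).
  rewrite (_ : (fun _ => _) = fun z => F i z * \prod_(j <- r | P j) F j z).
    exact: (entireM (Fe i) IH).
  by apply/funext => z; rewrite big_cons Pi.
rewrite (_ : (fun _ => _) = fun z => \prod_(j <- r | P j) F j z); first exact: IH.
by apply/funext => z; rewrite big_cons (negbTE Pi).
Qed.

End entire_closure.

Arguments entire_cst {R} c.
Arguments entire_expC {R}.
Arguments entire_id {R}.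

(** * Bisection of squares, integrals over segments *)

(** Supplies each coordinate of the point to which the nested squares in
    [square_bisection] shrink. *)
Lemma bisection_limit (R : realType) (u : R^nat) (L : R) : 0 < L ->
  (forall n, u n <= u n.+1 <= u n + L / 2 ^+ n.+1) ->
  exists x, forall n, u n <= x <= u n + L / 2 ^+ n.
Proof.
move=> L0 uS.
have uT n k : u n <= u (n + k)%N <= u n + (L / 2 ^+ n - L / 2 ^+ (n + k)).
  elim: k => [|k /andP[IH1 IH2]]; first by rewrite addn0 subrr addr0 lexx.
  have /andP[a b] := uS (n + k)%N; rewrite addnS (le_trans IH1 a) /=.
  apply: (le_trans b); move: IH2; rewrite exprS invfM.
  move: (2 ^+ (n + k))^-1 (2 ^+ n)^-1 => X Y; lra.
have p0 n : 0 < L / 2 ^+ n by rewrite divr_gt0 // exprn_gt0.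
have ub n : ubound (range u) (u n + L / 2 ^+ n).
  move=> _ [m _ <-]; have [nm|/ltnW mn] := leqP n m.
    have /andP[_ H] := uT n (m - n)%N; move: H; rewrite subnKC //.
    by have := p0 m; lra.
  have /andP[H _] := uT m (n - m)%N; move: H; rewrite subnKC //.
  by have := p0 n; lra.
have hs : has_sup (range u).
  by split; [exists (u 0%N); exists 0%N | exists (u 0%N + L / 2 ^+ 0); exact: ub].
exists (sup (range u)) => n; apply/andP; split.
  by apply: sup_upper_bound => //; exists n.
by apply: ge_sup (ub n); case: hs.
Qed.

(** If [P] failed on the square with lower left corner [(a, c)] and side [L], it
    would fail on one of its quarters, and so on; these nested squares shrink to
    a point, around which [P] holds on all small squares. *)
Lemma square_bisection (R : realType) (P : R -> R -> R -> Prop) :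
  (forall a c L, 0 < L -> P a c L -> P (a + L) c L -> P a (c + L) L ->
     P (a + L) (c + L) L -> P a c (L + L)) ->
  (forall x y, exists2 d, 0 < d & forall a c L, 0 < L < d ->
     a <= x <= a + L -> c <= y <= c + L -> P a c L) ->
  forall a c L, 0 < L -> P a c L.
Proof.
move=> Psplit Ploc a c L L0; apply: contrapT => nP.
have /choice[next nextP] : forall qL : R * R * R, exists q : R * R,
    0 < qL.2 -> ~ P qL.1.1 qL.1.2 qL.2 ->
    [/\ ~ P q.1 q.2 (qL.2 / 2), qL.1.1 <= q.1 <= qL.1.1 + qL.2 / 2
      & qL.1.2 <= q.2 <= qL.1.2 + qL.2 / 2].
  move=> [[x y] l] /=; have [l0|] := ltP 0 l; last by exists (0, 0).
  have h0 : 0 < l / 2 by rewrite divr_gt0.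
  have [H|H] := pselect (exists q : R * R, [/\ ~ P q.1 q.2 (l / 2),
     x <= q.1 <= x + l / 2 & y <= q.2 <= y + l / 2]).
    by have [q qP] := H; exists q.
  exists (0, 0) => _ nPl; exfalso; apply: nPl.
  have -> : l = l / 2 + l / 2 by lra.
  apply: Psplit => //; apply: contrapT => nPq; apply: H.
  - by exists (x, y); split=> //=; lra.
  - by exists (x + l / 2, y); split=> //=; lra.
  - by exists (x, y + l / 2); split=> //=; lra.
  - by exists (x + l / 2, y + l / 2); split=> //=; lra.
pose s := fix s n : R * R := if n is m.+1 then next (s m, L / 2 ^+ m) else (a, c).
have Ln0 n : 0 < L / 2 ^+ n by rewrite divr_gt0 // exprn_gt0.
have LS n : L / 2 ^+ n / 2 = L / 2 ^+ n.+1 by rewrite exprS invfM mulrA mulrAC.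
have sP n : ~ P (s n).1 (s n).2 (L / 2 ^+ n).
  elim: n => [|n IH]; first by rewrite expr0 divr1.
  by have [] := nextP (s n, L / 2 ^+ n) (Ln0 n) IH; rewrite /= LS.
have [|x xP] := @bisection_limit R (fun n => (s n).1) L L0.
  by move=> n; have [_ + _] := nextP (s n, L / 2 ^+ n) (Ln0 n) (sP n); rewrite /= LS.
have [|y yP] := @bisection_limit R (fun n => (s n).2) L L0.
  by move=> n; have [_ _ +] := nextP (s n, L / 2 ^+ n) (Ln0 n) (sP n); rewrite /= LS.
have [d d0 dP] := Ploc x y.
have [n Lnd] : exists n, L / 2 ^+ n < d.
  have := @cvg_geometric R L (2^-1); rewrite ger0_norm // invf_lt1 // ltr1n => /(_ isT).
  move/cvgrPdist_lt => /(_ _ d0) [n _ /(_ n (leqnn n))].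
  rewrite /= /geometric sub0r normrN exprVn ger0_norm; first by exists n.
  exact/ltW/Ln0.
by apply: (sP n); apply: dP; rewrite ?Ln0.
Qed.

Section segment_integral.
Variable R : realType.
Notation mu := (@lebesgue_measure R).
Implicit Types f g : R -> R.

Lemma continuous_segment_integrable f a b : continuous f ->
  mu.-integrable `[a, b] (EFin \o f).
Proof.
move=> cf; apply: continuous_compact_integrable; first exact: segment_compact.
exact: continuous_subspaceT.
Qed.

Lemma segment_integral_split f a m b : continuous f -> a <= m -> m <= b ->
  \int[mu]_(x in `[a, b]) f x =
  \int[mu]_(x in `[a, m]) f x + \int[mu]_(x in `[m, b]) f x.
Proof.
move=> cf am mb.
have := @Rintegral_itvB R f (BLeft a) (BRight b) m (@continuous_segment_integrable f a b cf).
rewrite !bnd_simp => /(_ am mb) /eqP; rewrite subr_eq => /eqP ->.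
rewrite Rintegral_itv_obnd_cbnd 1?addrC //.
apply: integrableS (@continuous_segment_integrable f m b cf) => //.
exact: subset_itv_oc_cc.
Qed.

(** Compares the integrals over two opposite sides of a square: there a function
    that is nearly linear takes values that differ nearly by a constant [k]. *)
Lemma segment_integral_sub_near f g a L k e : continuous f -> continuous g ->
  0 < L -> (forall x, a <= x <= a + L -> `|f x - g x - k| <= e) ->
  `|\int[mu]_(x in `[a, a + L]) f x - \int[mu]_(x in `[a, a + L]) g x - k * L|
    <= e * L.
Proof.
move=> cf cg L0 H.
have If := @continuous_segment_integrable f a (a + L) cf.
have Ig := @continuous_segment_integrable g a (a + L) cg.
have Ic (c : R) := @continuous_segment_integrable (fun=> c) a (a + L) (@cst_continuous _ _ c).
have Ifg : mu.-integrable `[a, a + L] (EFin \o (fun x => f x - g x)).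
  by apply: continuous_segment_integrable => x; apply: cvgB; [exact: cf|exact: cg].
have IL (c : R) : \int[mu]_(x in `[a, a + L]) c = c * L.
  rewrite Rintegral_cst //= lebesgue_measure_itv /= lte_fin ltrDl L0 /=.
  by congr (_ * _); rewrite addrAC subrr add0r.
rewrite -RintegralB // ler_distl -!mulrBl -mulrDl -!IL.
by apply/andP; split; apply: le_Rintegral => // x /=; rewrite in_itv /= => /H;
  rewrite ler_distl => /andP[].
Qed.

End segment_integral.

(** * Goursat's theorem for squares and the mean over a circle *)

Section Goursat.
Variable R : realType.
Notation mu := (@lebesgue_measure R).
Implicit Types f g : R[i] -> R[i].

Lemma entire_near f : entire f -> forall z eps, 0 < eps ->
  exists2 d, 0 < d & forall h, normc h < d -> normc (f (z + h) - f z) <= eps.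
Proof.
move=> fe z eps e0; have [l fl] := derivable_cderiv_at (fe z).
have [d d0 fd] := fl 1 ltr01.
have l1 : 0 < 1 + normc l by rewrite ltr_pwDl // normc_ge0.
exists (Num.min d (eps / (1 + normc l))); first by rewrite lt_min d0 divr_gt0.
move=> h; rewrite lt_min => /andP[/fd hd]; rewrite ltr_pdivlMr // => /ltW he.
have -> : f (z + h) - f z = (f (z + h) - f z - l * h) + l * h by rewrite subrK.
apply: (le_trans (le_normcD _ _)); apply: le_trans he.
by rewrite normcM mulrDr mulr1 (mulrC (normc h)) lerD2r; rewrite mul1r in hd.
Qed.

Lemma ReB (z w : R[i]) : complex.Re (z - w) = complex.Re z - complex.Re w.
Proof. by case: z; case: w. Qed.

(** The plane integrals live on [R * R]; its product topology is the one for which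
    continuity yields measurable integrands. *)
Lemma entire_continuous_Re f : entire f ->
  continuous (fun p : R * R => complex.Re (f (p.1 +i* p.2))).
Proof.
move=> fe p; apply/cvgrPdist_le => eps e0.
have [d d0 fd] := entire_near fe (p.1 +i* p.2) e0.
have d20 : 0 < d / 2 by rewrite divr_gt0.
exists (ball p.1 (d / 2), ball p.2 (d / 2)).
  by split; exact: nbhsx_ballx.
move=> q [/= q1 q2].
rewrite distrC.
have := fd ((q.1 - p.1) +i* (q.2 - p.2)).
have -> : p.1 +i* p.2 + ((q.1 - p.1) +i* (q.2 - p.2)) = q.1 +i* q.2.
  by apply/eqP; rewrite eq_complex /= !subrKC !eqxx.
move=> H; rewrite -ReB; apply: le_trans (normr_Re_le _) _; apply: H.
apply: le_lt_trans (normc_le _ _) _; rewrite [d]splitr; apply: ltrD.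
  by rewrite distrC.
by rewrite distrC.
Qed.

Lemma entire_mulNi f : entire f -> entire (fun z => - 'i%C * f z).
Proof. by move=> fe; exact: (entireM (entire_cst (- 'i%C)) fe). Qed.

Lemma Re_mulNi (z : R[i]) : complex.Re (- 'i%C * z) = complex.Im z.
Proof. by case: z => x y /=; ring. Qed.

Lemma entire_continuous_Im f : entire f ->
  continuous (fun p : R * R => complex.Im (f (p.1 +i* p.2))).
Proof.
move=> /entire_mulNi /entire_continuous_Re.
by under eq_fun do rewrite Re_mulNi.
Qed.

Lemma continuous_pair_l (T : topologicalType) (F : R * R -> T) (y : R) :
  continuous F -> continuous (fun x => F (x, y)).
Proof.
by move=> cF x; apply: (cvg_comp _ F (cvg_pair (@cvg_id _ (nbhs x)) (cvg_cst y))); exact: cF.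
Qed.

Lemma continuous_pair_r (T : topologicalType) (F : R * R -> T) (x : R) :
  continuous F -> continuous (fun y => F (x, y)).
Proof.
by move=> cF y; apply: (cvg_comp _ F (cvg_pair (cvg_cst x) (@cvg_id _ (nbhs y)))); exact: cF.
Qed.

Lemma entire_continuous_Im_horizontal f y : entire f ->
  continuous (fun x => complex.Im (f (x +i* y))).
Proof.
by move/entire_continuous_Im; exact: (@continuous_pair_l _ (fun p => complex.Im (f (p.1 +i* p.2)))).
Qed.

Lemma entire_continuous_Re_vertical f x : entire f ->
  continuous (fun y => complex.Re (f (x +i* y))).
Proof.
by move/entire_continuous_Re; exact: (@continuous_pair_r _ (fun p => complex.Re (f (p.1 +i* p.2)))).
Qed.

(** The imaginary part of the contour integral of [f] around the square with
    lower left corner [(a, c)] and side [L]. *)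
Definition square_circulation f (a c L : R) : R :=
  \int[mu]_(x in `[a, a + L]) complex.Im (f (x +i* c))
  - \int[mu]_(x in `[a, a + L]) complex.Im (f (x +i* (c + L)))
  + (\int[mu]_(y in `[c, c + L]) complex.Re (f ((a + L) +i* y))
     - \int[mu]_(y in `[c, c + L]) complex.Re (f (a +i* y))).

Lemma square_circulation_split f a c L : entire f -> 0 < L ->
  square_circulation f a c (L + L) =
  square_circulation f a c L + square_circulation f (a + L) c L
  + square_circulation f a (c + L) L + square_circulation f (a + L) (c + L) L.
Proof.
move=> fe L0; rewrite /square_circulation.
have H t y : \int[mu]_(x in `[t, t + (L + L)]) complex.Im (f (x +i* y)) =
   \int[mu]_(x in `[t, t + L]) complex.Im (f (x +i* y)) +
   \int[mu]_(x in `[t + L, t + L + L]) complex.Im (f (x +i* y)).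
  rewrite [in LHS]addrA; apply: segment_integral_split; last 2 first.
  - by rewrite lerDl ltW.
  - by rewrite lerDl ltW.
  exact: entire_continuous_Im_horizontal.
have V t x : \int[mu]_(y in `[t, t + (L + L)]) complex.Re (f (x +i* y)) =
   \int[mu]_(y in `[t, t + L]) complex.Re (f (x +i* y)) +
   \int[mu]_(y in `[t + L, t + L + L]) complex.Re (f (x +i* y)).
  rewrite [in LHS]addrA; apply: segment_integral_split; last 2 first.
  - by rewrite lerDl ltW.
  - by rewrite lerDl ltW.
  exact: entire_continuous_Re_vertical.
rewrite !H !V !addrA; ring.
Qed.

(** Replacing [f] by its linear part [lin] at [x +i* y] would make the
    circulation zero, as the contributions [- L Re l] and [L Re l] of the two pairs
    of opposite sides cancel.  The remainder is at most [eps / 4 * L] on a square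
    of side [L] that contains the point, whence a bound of order [eps * L ^ 2]. *)
Lemma square_circulation_local f x y eps : entire f -> 0 < eps ->
  exists2 d, 0 < d & forall a c L, 0 < L < d -> a <= x <= a + L ->
    c <= y <= c + L -> `|square_circulation f a c L| <= eps * L ^+ 2.
Proof.
move=> fe e0; have [l fl] := derivable_cderiv_at (fe (x +i* y)).
have e80 : 0 < eps / 8 by rewrite divr_gt0.
have [d d0 fd] := fl _ e80.
exists (d / 2); first by rewrite divr_gt0.
move=> a c L /andP[L0 Ld] xa yc.
pose lin (z : R[i]) := f (x +i* y) + l * (z - (x +i* y)).
have near s t : a <= s <= a + L -> c <= t <= c + L ->
    normc (f (s +i* t) - lin (s +i* t)) <= eps / 4 * L.
  move=> sa tc; have := fd ((s +i* t) - (x +i* y)); rewrite subrKC.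
  have N : normc ((s +i* t) - (x +i* y)) <= 2 * L.
    apply: le_trans (normc_le (s - x) (t - y)) _.
    have : `|s - x| <= L by rewrite ler_distl; lra.
    have : `|t - y| <= L by rewrite ler_distl; lra.
    lra.
  rewrite /lin opprD addrA => /(_ (le_lt_trans N _)) H.
  apply: le_trans (H _) _; first lra.
  have : eps / 8 * normc ((s +i* t) - (x +i* y)) <= eps / 8 * (2 * L) by rewrite ler_pM2l.
  lra.
have eaL : a <= a <= a + L by lra.
have eaL' : a <= a + L <= a + L by lra.
have ecL : c <= c <= c + L by lra.
have ecL' : c <= c + L <= c + L by lra.
have cI t := @entire_continuous_Im_horizontal f t fe.
have cR s := @entire_continuous_Re_vertical f s fe.
have B1 := @segment_integral_sub_near R _ _ a L (- (L * complex.Re l)) (eps / 2 * L)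
  (cI c) (cI (c + L)) L0.
have B2 := @segment_integral_sub_near R _ _ c L (L * complex.Re l) (eps / 2 * L)
  (cR (a + L)) (cR a) L0.
have D1 s : a <= s <= a + L -> `|complex.Im (f (s +i* c)) - complex.Im (f (s +i* (c + L)))
    - - (L * complex.Re l)| <= eps / 2 * L.
  move=> sa.
  have := le_trans (normr_Im_le _) (near s c sa ecL).
  have := le_trans (normr_Im_le _) (near s (c + L) sa ecL').
  rewrite /lin; case: (f (s +i* c)) (f (s +i* (c + L))) (f (x +i* y)) (l)
    => [? ?] [? ?] [? ?] [? ?] /=.
  rewrite !ler_norml; lra.
have D2 t : c <= t <= c + L -> `|complex.Re (f ((a + L) +i* t)) - complex.Re (f (a +i* t))
    - L * complex.Re l| <= eps / 2 * L.
  move=> tc.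
  have := le_trans (normr_Re_le _) (near a t eaL tc).
  have := le_trans (normr_Re_le _) (near (a + L) t eaL' tc).
  rewrite /lin; case: (f (a +i* t)) (f ((a + L) +i* t)) (f (x +i* y)) (l)
    => [? ?] [? ?] [? ?] [? ?] /=.
  rewrite !ler_norml; lra.
move: (B1 D1) (B2 D2); rewrite /square_circulation !ler_norml expr2.
move: (\int[mu]_(_ in _) _) (\int[mu]_(_ in _) _) (\int[mu]_(_ in _) _) (\int[mu]_(_ in _) _).
move=> I1 I2 I3 I4; lra.
Qed.

(** Goursat's argument: both the circulation and the area are additive over the
    four quarters of a square, so the local bound by [e] times the area spreads
    to every square, for every [e]. *)
Theorem square_circulation_eq0 f a c L : entire f -> 0 < L ->
  square_circulation f a c L = 0.
Proof.
move=> fe L0; apply/eqP; rewrite -normr_le0; apply/ler_addgt0Pl => eps e0.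
rewrite addr0.
have L20 : 0 < L ^+ 2 by rewrite exprn_gt0.
have ee0 : 0 < eps / L ^+ 2 by rewrite divr_gt0.
rewrite -[leRHS](divfK (lt0r_neq0 L20)).
move: (_ / _) ee0 => e {}e0.
apply: (@square_bisection R (fun a c L => `|square_circulation f a c L| <= e * L ^+ 2)) => //.
  move=> {a c L L0 L20} a c L L0 H1 H2 H3 H4; rewrite square_circulation_split //.
  move: H1 H2 H3 H4; rewrite !ler_norml !expr2; lra.
by move=> x y; exact: square_circulation_local.
Qed.

(** As a function of [zeta], [g (expC zeta * z)] has period [2 pi i]; on a square
    of side [2 pi] the horizontal sides therefore cancel, and the integrals [M]
    over the vertical segments at abscissas [s] and [s + 2 pi] agree.  As [s]
    decreases to [-oo], the circle shrinks to 0 and continuity gives the value. *)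
Theorem circle_mean_value g z : entire g ->
  \int[mu]_(t in `[0, 2 * pi]) complex.Re (g (expC (0 +i* t) * z))
    = complex.Re (g 0) * (2 * pi).
Proof.
move=> ge; pose G zeta := g (expC zeta * z).
have Ge : entire G.
  exact: (entire_comp ge (entireM entire_expC (entire_cst z))).
pose L : R := 2 * pi.
have L0 : 0 < L by rewrite mulr_gt0 // pi_gt0.
pose M s := \int[mu]_(t in `[0, L]) complex.Re (G (s +i* t)).
have MS s : M (s + L) = M s.
  have := @square_circulation_eq0 G s 0 L Ge L0.
  rewrite /square_circulation !add0r.
  have E x : G (x +i* L) = G (x +i* 0).
    rewrite /G; congr (g (_ * z)); rewrite /expC /=.
    by rewrite /L (mulrC 2) mulr_natr cos2pi sin2pi cos0 sin0.
  under [X in _ - X + _]eq_Rintegral do rewrite E.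
  by rewrite subrr add0r => /eqP; rewrite subr_eq0 => /eqP.
have Mk k : M 0 = M (- (L * k%:R)).
  elim: k => [|k ->]; first by rewrite mulr0 oppr0.
  by rewrite -[in RHS](MS _); congr M; rewrite -natr1; ring.
have cR s := @entire_continuous_Re_vertical G s Ge.
apply/eqP; rewrite -subr_eq0 -normr_le0; apply/ler_addgt0Pl => eps e0; rewrite addr0.
have eL0 : 0 < eps / L by rewrite divr_gt0.
have [d d0 gd] := entire_near ge 0 eL0.
have [k kd] : exists k, expR (- (L * k%:R)) * normc z < d.
  have z1 : 0 < 1 + normc z by rewrite ltr_pwDl // normc_ge0.
  have [k Hk] : exists k : nat, (1 + normc z) / (d * L) < k%:R.
    exists (Num.bound ((1 + normc z) / (d * L))); apply: archi_boundP.
    by apply: divr_ge0; apply: ltW => //; exact: (mulr_gt0 d0 L0).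
  exists k; rewrite expRN mulrC ltr_pdivrMr ?expR_gt0 //.
  rewrite (ltr_pdivrMr _ _ (mulr_gt0 d0 L0)) in Hk.
  have := expR_ge1Dx (L * k%:R); have := normc_ge0 z; nra.
have := @segment_integral_sub_near R _ _ 0 L (complex.Re (g 0)) (eps / L)
  (cR (- (L * k%:R))) (@cst_continuous _ _ (0 : R)) L0.
rewrite !add0r Rintegral_cst // mul0r subr0 (divfK (lt0r_neq0 L0)) -/(M _) -Mk.
have -> : M 0 = \int[mu]_(t in `[0, L]) complex.Re (g (expC (0 +i* t) * z)) by [].
apply=> t _; rewrite subr0 /G -ReB; apply: le_trans (normr_Re_le _) _.
have := gd (expC ((- (L * k%:R)) +i* t) * z); rewrite add0r; apply.
by rewrite normcM normc_expC.
Qed.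

End Goursat.

(** * Maps that preserve the Lebesgue measure of the plane *)

Section plane_integral.
Variable R : realType.
Notation mu := (@lebesgue_measure R).
Notation mu2 := (mu \x mu)%E.

(** Boxes with rational centre and radius form a countable basis, so an open set
    is the union of those that it contains. *)
Lemma open_plane_measurable (U : set (R * R)) : open U ->
  measurable (U : set (measurableTypeR R * measurableTypeR R)).
Proof.
move=> oU.
pose box (q : rat * rat * rat) : set (R * R) :=
  ball (ratr q.1.1 : R) (ratr q.2) `*` ball (ratr q.1.2 : R) (ratr q.2).
pose F q : set (measurableTypeR R * measurableTypeR R) :=
  if `[< box q `<=` U >] then box q else set0.
rewrite (_ : U = \bigcup_q F q); last first.
  apply/seteqP; split=> [[x y] Uxy|p [q _]]; last first.
    by rewrite /F; case: asboolP => // + qp; apply.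
  move: oU; rewrite openE => /(_ _ Uxy) [[A B] [/= /nbhs_ballP[r1 /= r10 rA]]].
  move=> /nbhs_ballP[r2 /= r20 rB] AB.
  have r0 : 0 < Num.min r1 r2 / 2 by rewrite divr_gt0 // lt_min r10 r20.
  have [r /itvP rr] := rat_in_itvoo r0.
  have e0 : (0 : R) < ratr r by rewrite rr.
  have er : 2 * ratr r < Num.min r1 r2.
    have : ratr r < Num.min r1 r2 / 2 by rewrite rr.
    lra.
  have rat_near (t : R) : exists q : rat, `|ratr q - t| < ratr r.
    have [|q /itvP qr] := @rat_in_itvoo R (t - ratr r) (t + ratr r); first lra.
    by exists q; rewrite ltr_distl !qr.
  have [a ax] := rat_near x; have [b b_y] := rat_near y.
  exists (a, b, r) => //; rewrite /F; case: asboolP => [_|[]].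
    by split.
  move=> [u v] [/= ua vb]; apply: AB; split => /=.
  - apply: rA; rewrite /ball /= in ua *; apply: lt_le_trans (_ : 2 * ratr r <= _).
      apply: le_lt_trans (ler_distD (ratr a) _ _) _.
      by rewrite mulr_natl mulr2n; apply: ltrD => //; rewrite distrC.
    by apply: ltW; apply: lt_le_trans er _; rewrite ge_min lexx.
  - apply: rB; rewrite /ball /= in vb *; apply: lt_le_trans (_ : 2 * ratr r <= _).
      apply: le_lt_trans (ler_distD (ratr b) _ _) _.
      by rewrite mulr_natl mulr2n; apply: ltrD => //; rewrite distrC.
    by apply: ltW; apply: lt_le_trans er _; rewrite ge_min lexx orbT.
apply: countable_bigcupT_measurable => // q; rewrite /F; case: ifP => _ //.
by apply: measurableX; rewrite ball_itv; exact: measurable_itv.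
Qed.

Lemma continuous_plane_measurable (f : R * R -> R) : continuous f ->
  measurable_fun setT (f : measurableTypeR R * measurableTypeR R -> measurableTypeR R).
Proof.
move=> cf; apply: (measurability _ (RGenOpens.measurableE R)).
move=> _ [_ [a [b ->] <-]]; rewrite setTI; apply: open_plane_measurable.
by move/continuousP: cf; apply; exact: interval_open.
Qed.

(** Stated on nonnegative functions, for which Tonelli's theorem requires no
    integrability; [plane_preserving_integral] extends it to all functions. *)
Definition plane_preserving (T : R * R -> R * R) :=
  measurable_fun setT T /\
  forall f : R * R -> \bar R, measurable_fun setT f -> (forall p, 0 <= f p)%E ->
    (\int[mu2]_p f (T p) = \int[mu2]_p f p)%E.

Lemma plane_preserving_integral T (f : R * R -> \bar R) : plane_preserving T ->
  measurable_fun setT f -> (\int[mu2]_p f (T p) = \int[mu2]_p f p)%E.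
Proof.
move=> [mT HT] mf; rewrite integralE [RHS]integralE.
rewrite -(HT (f^\+)%E); [|exact: measurable_funepos|by []].
rewrite -(HT (f^\-)%E); [|exact: measurable_funeneg|by []].
by rewrite -[fun p => f (T p)]/(f \o T) funepos_comp funeneg_comp.
Qed.

Lemma plane_preserving_comp S T :
  plane_preserving S -> plane_preserving T -> plane_preserving (S \o T).
Proof.
move=> [mS HS] [mT HT]; split; first exact: measurableT_comp.
move=> f mf f0; rewrite -(HS f mf f0).
by apply: (HT (f \o S)) => [|p]; [exact: measurableT_comp|exact: f0].
Qed.

Lemma lebesgue_integral_translate (f : R -> \bar R) (t : R) :
  measurable_fun setT f -> (forall x, 0 <= f x)%E ->
  (\int[mu]_x f (x + t)%R = \int[mu]_x f x)%E.
Proof.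
move=> mf f0.
have mt : measurable_fun setT (fun x : measurableTypeR R => (x + t : measurableTypeR R)).
  exact: measurable_funD.
transitivity (\int[pushforward mu (fun x : measurableTypeR R => (x + t)%R : measurableTypeR R)]_x f x)%E.
  by rewrite ge0_integral_pushforward.
apply: eq_measure_integral => //= A mA _; apply/esym/lebesgue_measure_unique => //= _ [[a b]] _ <-.
rewrite /pushforward.
have -> : (fun x => x + t) @^-1` [set` `]a, b] ] = `]a - t, b - t]%classic.
  by apply/seteqP; split=> x /=; rewrite !in_itv /= ltrBlDr lerBrDr.
rewrite !lebesgue_measure_itv /= !lte_fin ltrD2r.
by case: ifP => // _; rewrite -!EFinB; congr (_%:E); ring.
Qed.

Lemma plane_tonelli_xy (f : R * R -> \bar R) :
  measurable_fun setT f -> (forall p, 0 <= f p)%E ->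
  (\int[mu2]_p f p = \int[mu]_x \int[mu]_y f (x, y))%E.
Proof. by move=> mf f0; exact: fubini_tonelli1. Qed.

Lemma plane_tonelli_yx (f : R * R -> \bar R) :
  measurable_fun setT f -> (forall p, 0 <= f p)%E ->
  (\int[mu2]_p f p = \int[mu]_y \int[mu]_x f (x, y))%E.
Proof. by move=> mf f0; exact: fubini_tonelli2. Qed.

(** By Tonelli, a shear is a translation of each horizontal line. *)
Lemma plane_preserving_shear1 (phi : R -> R) : measurable_fun setT phi ->
  plane_preserving (fun p => (p.1 + phi p.2, p.2)).
Proof.
move=> mphi.
have mT : measurable_fun setT (fun p : R * R => (p.1 + phi p.2, p.2)).
  by apply: measurable_fun_pair => //; apply: measurable_funD => //; exact: measurableT_comp.
split=> // f mf f0.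
rewrite (@plane_tonelli_yx (fun p => f (p.1 + phi p.2, p.2))) //; last exact: (measurableT_comp mf mT).
rewrite (@plane_tonelli_yx f) //; apply: eq_integral => y _ /=.
apply: (@lebesgue_integral_translate (fun x => f (x, y))) => //.
exact: measurable_fun_pair1.
Qed.

Lemma plane_preserving_shear2 (phi : R -> R) : measurable_fun setT phi ->
  plane_preserving (fun p => (p.1, p.2 + phi p.1)).
Proof.
move=> mphi.
have mT : measurable_fun setT (fun p : R * R => (p.1, p.2 + phi p.1)).
  by apply: measurable_fun_pair => //; apply: measurable_funD => //; exact: measurableT_comp.
split=> // f mf f0.
rewrite (@plane_tonelli_xy (fun p => f (p.1, p.2 + phi p.1))) //; last exact: (measurableT_comp mf mT).
rewrite (@plane_tonelli_xy f) //; apply: eq_integral => x _ /=.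
apply: (@lebesgue_integral_translate (fun y => f (x, y))) => //.
exact: measurable_fun_pair2.
Qed.

Lemma plane_preserving_translation (a b : R) :
  plane_preserving (fun p => (p.1 + a, p.2 + b)).
Proof.
exact: (plane_preserving_comp (@plane_preserving_shear1 (cst a) (measurable_cst _))
  (@plane_preserving_shear2 (cst b) (measurable_cst _))).
Qed.

(** The rotation of angle [theta] is the product of a horizontal, a vertical and
    again a horizontal shear, with coefficients [t], [s = sin theta] and [t],
    where [t = - tan (theta / 2) = - s / (1 + c)].  This excludes the half turn,
    which is the square of a quarter turn. *)
Lemma plane_preserving_rotation (c s : R) : c ^+ 2 + s ^+ 2 = 1 ->
  plane_preserving (fun p => (p.1 * c - p.2 * s, p.1 * s + p.2 * c)).
Proof.
have main : forall c s : R, c != -1 -> c ^+ 2 + s ^+ 2 = 1 ->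
    plane_preserving (fun p => (p.1 * c - p.2 * s, p.1 * s + p.2 * c)).
  move=> {}c {}s cN1 cs1; have c10 : 1 + c != 0 by rewrite addrC -[1]opprK subr_eq0.
  pose t := - s / (1 + c).
  have lin k : measurable_fun setT (fun x : R => x * k) by exact: mulrr_measurable.
  have := plane_preserving_comp (plane_preserving_shear1 (lin t))
    (plane_preserving_comp (plane_preserving_shear2 (lin s)) (plane_preserving_shear1 (lin t))).
  congr plane_preserving; apply/funext => -[x y] /=.
  have ts : 1 + t * s = c.
    apply: (mulIf c10); rewrite mulrDl mul1r mulrAC /t divfK // mulrDr mulr1.
    by rewrite -expr2 mulNr -expr2 -cs1; ring.
  have tc : t + t * c = - s by rewrite -[X in X + _]mulr1 -mulrDr /t divfK.
  congr (_, _).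
  - transitivity (x * (1 + t * s) + y * (t + t * (1 + t * s))); first by ring.
    by rewrite ts tc mulrN.
  - by rewrite -ts; ring.
move=> cs1; have [cN1|cN1] := eqVneq c (-1); last exact: main.
have s0 : s = 0.
  by apply/eqP; rewrite -sqrf_eq0; move: cs1; rewrite cN1 sqrrN expr1n => ?; apply/eqP; lra.
have q : plane_preserving (fun p => (p.1 * 0 - p.2 * 1, p.1 * 1 + p.2 * 0)).
  by apply: main; [rewrite eq_sym oppr_eq0 oner_eq0 | rewrite expr0n expr1n add0r].
have := plane_preserving_comp q q.
congr plane_preserving; apply/funext => -[x y] /=; rewrite cN1 s0.
by congr (_, _); ring.
Qed.

End plane_integral.

(** * The Gaussian mean value property *)

Section gaussian_mean.
Variable R : realType.
Notation mu := (@lebesgue_measure R).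
Notation mu2 := (mu \x mu)%E.

Lemma plane_sigma_finite : sigma_finite setT mu2.
Proof.
have /sigma_finiteP[F [TF ndF Foo]] := sigma_finiteT mu.
exists (fun n => F n `*` F n).
  rewrite -setXTT TF predeqE => -[x y]; split.
    move=> [/= [n _ Fnx] [k _ Fky]]; exists (maxn n k) => //; split.
    - by move: x Fnx; exact/subsetPset/ndF/leq_maxl.
    - by move: y Fky; exact/subsetPset/ndF/leq_maxr.
  by move=> [n _ []/= ? ?]; split; exists n.
move=> k; have [? ?] := Foo k.
split; first exact: measurableX.
by rewrite product_measure1E // lte_mul_pinfty // ge0_fin_numE.
Qed.

(** The product measure with its sigma-finite structure, which Fubini's theorem
    on [R * (R * R)] asks of its second factor. *)
Definition plane_measure :
    {sigma_finite_measure set (measurableTypeR R * measurableTypeR R)%type -> \bar R} :=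
  HB.pack mu2 (@Measure_isSigmaFinite.Build _ _ _ mu2 plane_sigma_finite).

Definition gauss2 (p : R * R) : R := expR (- (p.1 ^+ 2 + p.2 ^+ 2)).

Lemma gauss2_gt0 p : 0 < gauss2 p. Proof. exact: expR_gt0. Qed.

Lemma gauss2_gauss_fun x y : gauss2 (x, y) = gauss_fun x * gauss_fun y.
Proof. by rewrite /gauss2 /gauss_fun -expRD opprD. Qed.

Lemma measurable_gauss2 : measurable_fun setT gauss2.
Proof.
apply: measurableT_comp => //; apply: measurable_funN.
by apply: measurable_funD; apply: measurable_funX.
Qed.

Lemma integral_gauss2 : (\int[mu2]_p (gauss2 p)%:E = pi%:E)%E.
Proof.
rewrite plane_tonelli_xy; last 2 first.
- by apply/measurable_EFinP; exact: measurable_gauss2.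
- by move=> p; rewrite lee_fin ltW // gauss2_gt0.
have mg : measurable_fun setT (EFin \o @gauss_fun R).
  by apply/measurable_EFinP; exact: measurable_gauss_fun.
have g0 x : (0 <= (@gauss_fun R x)%:E)%E by rewrite lee_fin gauss_fun_ge0.
transitivity (\int[mu]_x ((Num.sqrt pi)%:E * (gauss_fun x)%:E))%E.
  apply: eq_integral => x _; under eq_integral do rewrite gauss2_gauss_fun EFinM.
  by rewrite ge0_integralZl // integralT_gauss muleC.
rewrite ge0_integralZl // ?lee_fin ?sqrtr_ge0 // integralT_gauss -EFinM.
by rewrite -expr2 sqr_sqrtr // pi_ge0.
Qed.

Lemma integrable_gauss2 : mu2.-integrable setT (EFin \o gauss2).
Proof.
apply/integrableP; split; first by apply/measurable_EFinP; exact: measurable_gauss2.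
under eq_integral do rewrite /= ger0_norm ?expR_ge0 //.
by rewrite integral_gauss2 ltry.
Qed.

Lemma entire_measurable_Re (g : R[i] -> R[i]) : entire g ->
  measurable_fun setT (fun p : R * R => complex.Re (g (p.1 +i* p.2))).
Proof. by move=> /entire_continuous_Re /continuous_plane_measurable. Qed.

Definition rotate (t : R) (p : R * R) : R * R :=
  (p.1 * cos t - p.2 * sin t, p.1 * sin t + p.2 * cos t).

Lemma gauss2_rotate t p : gauss2 (rotate t p) = gauss2 p.
Proof.
congr (expR (- _)); rewrite /rotate /=.
transitivity ((p.1 ^+ 2 + p.2 ^+ 2) * (cos t ^+ 2 + sin t ^+ 2)); first by ring.
by rewrite cos2Dsin2 mulr1.
Qed.

Lemma plane_preserving_rotate t : plane_preserving (rotate t).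
Proof. by apply: plane_preserving_rotation; rewrite cos2Dsin2. Qed.

Lemma measurable_rotate : measurable_fun setT (fun q : R * (R * R) => rotate q.1 q.2).
Proof.
have mcos : measurable_fun setT (fun q : R * (R * R) => cos q.1).
  by apply: measurableT_comp => //; apply: continuous_measurable_fun; exact: continuous_cos.
have msin : measurable_fun setT (fun q : R * (R * R) => sin q.1).
  by apply: measurableT_comp => //; apply: continuous_measurable_fun; exact: continuous_sin.
have m1 : measurable_fun setT (fun q : R * (R * R) => q.2.1) by exact: measurableT_comp.
have m2 : measurable_fun setT (fun q : R * (R * R) => q.2.2) by exact: measurableT_comp.
by apply: measurable_fun_pair; [apply: measurable_funB|apply: measurable_funD];
  apply: measurable_funM.
Qed.

Lemma expC_mul_rotate t (p : R * R) :
  expC (0 +i* t) * (p.1 +i* p.2) = (rotate t p).1 +i* (rotate t p).2.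
Proof.
rewrite /expC /rotate /= expR0 !mul1r.
by apply/eqP; rewrite eq_complex /=; apply/andP; split; apply/eqP; ring.
Qed.

(** The integral [I] of [k = Re g * gauss2] is unchanged when [k] is rotated by
    any angle [t], hence [2 pi I] is the double integral of the rotated [k] over
    the plane and over [t] in [[0, 2 pi]].  By Fubini, integrate over [t] first:
    the weight is rotation invariant, so [circle_mean_value] yields
    [2 pi Re (g 0) gauss2], whose integral over the plane is [2 pi Re (g 0) pi]. *)
Theorem gaussian_mean_value (g : R[i] -> R[i]) : entire g ->
  mu2.-integrable setT (fun p => (complex.Re (g (p.1 +i* p.2)) * gauss2 p)%:E) ->
  (\int[mu2]_p (complex.Re (g (p.1 +i* p.2)) * gauss2 p)%:E = (complex.Re (g 0) * pi)%:E)%E.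
Proof.
move=> ge; pose k (p : R * R) := complex.Re (g (p.1 +i* p.2)) * gauss2 p.
rewrite -/(EFin \o k) => ik.
have mk : measurable_fun setT k.
  by apply: measurable_funM; [exact: entire_measurable_Re|exact: measurable_gauss2].
have pi20 : 0 < 2 * pi :> R by rewrite mulr_gt0 // pi_gt0.
pose D : set R := `[0, 2 * pi]%classic.
have mD : measurable D by exact: measurable_itv.
have muD : mu D = (2 * pi)%:E by rewrite /D lebesgue_measure_itv /= lte_fin pi20 oppr0 adde0.
pose K (q : R * (R * R)) : \bar R := (k (rotate q.1 q.2) * \1_D q.1)%:E.
have mK : measurable_fun setT K.
  apply/measurable_EFinP; apply: measurable_funM.
    exact: (measurableT_comp mk measurable_rotate).
  by apply: measurableT_comp.
(* Integrating over the plane first gives a constant on [D], by rotation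
   invariance. *)
have inner (F : R -> R) t : measurable_fun setT F ->
    (\int[mu2]_p (F (k (rotate t p)))%:E = \int[mu2]_p (F (k p))%:E)%E.
  move=> mF; apply: (plane_preserving_integral (plane_preserving_rotate t)
    (f := fun p => (F (k p))%:E)).
  by apply/measurable_EFinP; exact: (measurableT_comp mF mk).
have cstD (c : \bar R) : (\int[mu]_t ((cst c) \_ D) t = c * (2 * pi)%:E)%E.
  rewrite -integral_mkcond integral_cst //; congr (_ * _)%E; exact: muD.
have /(iffRL (@integrable12ltyP _ _ (measurableTypeR R) _ R mu plane_measure K mK)) iK :
    (\int[mu]_t \int[plane_measure]_p `|K (t, p)| < +oo)%E.
  have -> : (\int[mu]_t \int[plane_measure]_p `|K (t, p)| =
      \int[mu]_t ((cst (\int[mu2]_p `|(k p)%:E|)) \_ D) t)%E.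
    apply: eq_integral => t _; rewrite patchE /K /=; case: ifPn => tD.
      rewrite indicE tD /=; under eq_integral do rewrite mulr1.
      exact: (inner (fun x => `|x|)).
    rewrite indicE (negbTE tD) /=; under eq_integral do rewrite mulr0 normr0.
    exact: integral0.
  rewrite cstD; case/integrableP: ik => _ ik; apply: lte_mul_pinfty.
  - by apply: integral_ge0.
  - by rewrite ge0_fin_numE //; apply: integral_ge0.
  - exact: ltry.
have := Fubini iK.
have -> : (\int[mu]_t \int[plane_measure]_p K (t, p) =
    \int[mu]_t ((cst (\int[mu2]_p (k p)%:E)) \_ D) t)%E.
  apply: eq_integral => t _; rewrite patchE /K /=; case: ifPn => tD.
    rewrite indicE tD /=; under eq_integral do rewrite mulr1.
    exact: (inner id).
  rewrite indicE (negbTE tD) /=; under eq_integral do rewrite mulr0.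
  exact: integral0.
rewrite cstD.
have -> : (\int[plane_measure]_p \int[mu]_t K (t, p) =
    \int[mu2]_p ((complex.Re (g 0) * (2 * pi))%:E * (gauss2 p)%:E))%E.
  apply: eq_integral => p _.
  (* At fixed [p], the inner integral is a mean over the circle through [p]. *)
  rewrite -(circle_mean_value (p.1 +i* p.2) ge).
  have -> : (\int[mu]_t K (t, p) = \int[mu]_(t in D) (k (rotate t p))%:E)%E.
    rewrite [RHS]integral_mkcond; apply: eq_integral => t _.
    by rewrite patchE /K /= indicE; case: (_ \in _); rewrite ?mulr1 ?mulr0.
  have cG : continuous (fun t => complex.Re (g (expC (0 +i* t) * (p.1 +i* p.2)))).
    have Ge : entire (fun zeta => g (expC zeta * (p.1 +i* p.2))).
      exact: (entire_comp ge (entireM entire_expC (entire_cst _))).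
    exact: (@entire_continuous_Re_vertical R _ 0 Ge).
  have iG := @continuous_segment_integrable R _ 0 (2 * pi) cG.
  rewrite /Rintegral fineK; last exact: integrable_fin_num.
  rewrite -integralZr //.
  by apply: eq_integral => t _; rewrite /k gauss2_rotate -expC_mul_rotate EFinM.
rewrite integralZl //; last exact: integrable_gauss2.
rewrite integral_gauss2 => /eqP; rewrite -EFinM mulrAC [X in _ == X]EFinM.
have := integrable_fin_num measurableT ik.
move: (integral _ _ _) => I /fineK <-; rewrite -!EFinM eqe => /eqP /mulIf -> //.
by rewrite gt_eqF.
Qed.

End gaussian_mean.

(** * The real inner product of the Fock space *)

Section fock_space.
Variable R : realType.
Notation mu := (@lebesgue_measure R).
Notation mu2 := (mu \x mu)%E.
Implicit Types f g h : R[i] -> R[i].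

(** Only real parts of inner products matter for the variation of a squared norm;
    [re_dot] is the real inner product that underlies the Fock norm. *)
Definition cross_density f g (p : R * R) : R :=
  complex.Re (f (p.1 +i* p.2) * (g (p.1 +i* p.2))^*%C) * gauss2 p.

Definition re_dot f g : R := pi^-1 * \int[mu2]_p cross_density f g p.

Lemma cross_density_normc f p :
  cross_density f f p = normc (f (p.1 +i* p.2)) ^+ 2 * gauss2 p.
Proof. by rewrite /cross_density normc_sqr; case: (f _) => x y /=; congr (_ * _); ring. Qed.

Lemma cross_density_ge0 f p : 0 <= cross_density f f p.
Proof. by rewrite cross_density_normc mulr_ge0 ?sqr_ge0 // ltW ?gauss2_gt0. Qed.

Lemma measurable_cross_density f g : entire f -> entire g ->
  measurable_fun setT (cross_density f g).
Proof.
move=> fe ge; apply: measurable_funM; last exact: measurable_gauss2.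
have Im h : entire h -> measurable_fun setT (fun p : R * R => complex.Im (h (p.1 +i* p.2))).
  by move=> /entire_continuous_Im /continuous_plane_measurable.
rewrite (_ : (fun _ => _) = (fun p => complex.Re (f (p.1 +i* p.2)) * complex.Re (g (p.1 +i* p.2))
   + complex.Im (f (p.1 +i* p.2)) * complex.Im (g (p.1 +i* p.2)))).
  by apply: measurable_funD; apply: measurable_funM; first [exact: entire_measurable_Re|exact: Im].
by apply/funext => p; case: (f _) => a b; case: (g _) => c d /=; ring.
Qed.

Lemma fock_sqnormE f :
  fock_sqnorm f = ((pi^-1)%:E * \int[mu2]_p (cross_density f f p)%:E)%E.
Proof.
congr (_ * _)%E; apply: eq_integral => p _; rewrite cross_density_normc.
by rewrite /gauss2 -[in RHS](normc_sqr (p.1 +i* p.2)).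
Qed.

Lemma fockP f : fock f <->
  entire f /\ mu2.-integrable setT (EFin \o cross_density f f).
Proof.
have pi10 : 0 < pi^-1 :> R by rewrite invr_gt0 pi_gt0.
rewrite /fock /= fock_sqnormE; split=> -[fe fi]; split=> //.
  apply/integrableP; split.
    by apply/measurable_EFinP; exact: measurable_cross_density.
  under eq_integral do rewrite /= ger0_norm ?cross_density_ge0 //.
  move: fi; rewrite muleC; case: (integral _ _ _) => [r _| |]; [by rewrite ltry| |by []].
  by rewrite gt0_mulye ?lte_fin.
have /fineK <- := integrable_fin_num measurableT fi.
by rewrite -EFinM ltry.
Qed.

(** Domination by [|f|^2 + |g|^2]. *)
Lemma integrable_cross_density f g : fock f -> fock g ->
  mu2.-integrable setT (EFin \o cross_density f g).
Proof.
move=> /fockP[fe fi] /fockP[ge gi].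
apply: (@le_integrable _ _ _ mu2 _ measurableT _
  (fun p => ((cross_density f f p)%:E + (cross_density g g p)%:E)%E)).
- by apply/measurable_EFinP; exact: measurable_cross_density.
- move=> p _; rewrite /= lee_fin.
  rewrite (ger0_norm (addr_ge0 (cross_density_ge0 f p) (cross_density_ge0 g p))).
  rewrite /cross_density -mulrDl normrM (ger0_norm (ltW (gauss2_gt0 p))).
  apply: ler_wpM2r; first exact/ltW/gauss2_gt0.
  case: (f _) => a b; case: (g _) => c d /=; rewrite ler_norml.
  have := sqr_ge0 (a - c); have := sqr_ge0 (b - d).
  have := sqr_ge0 (a + c); have := sqr_ge0 (b + d).
  have := sqr_ge0 a; have := sqr_ge0 b; have := sqr_ge0 c; have := sqr_ge0 d.
  by rewrite !expr2 => *; apply/andP; split; lra.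
- exact: integrableD.
Qed.

Lemma fock_sqnorm_re_dot f : fock f -> fock_sqnorm f = (re_dot f f)%:E.
Proof.
move=> /fockP[fe fi]; rewrite fock_sqnormE /re_dot EFinM /Rintegral fineK //.
exact: integrable_fin_num.
Qed.

Lemma re_dot_ge0 f : 0 <= re_dot f f.
Proof.
rewrite mulr_ge0 ?invr_ge0 ?pi_ge0 //; apply: Rintegral_ge0 => p _.
exact: cross_density_ge0.
Qed.

Lemma fock_scale (c : R[i]) f : fock f -> fock (fun z => c * f z).
Proof.
move=> /fockP[fe fi]; apply/fockP; split.
  exact: (entireM (entire_cst c) fe).
rewrite (_ : EFin \o _ = fun p => ((normc c ^+ 2)%:E * (cross_density f f p)%:E)%E).
  exact: integrableZl.
apply/funext => p; rewrite /= !cross_density_normc normcM exprMn -EFinM; congr _%:E; ring.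
Qed.

Lemma cross_densityDr f g h p :
  cross_density f (fun z => g z + h z) p = cross_density f g p + cross_density f h p.
Proof.
rewrite /cross_density -mulrDl; congr (_ * _).
by case: (f _) => a b; case: (g _) => c d; case: (h _) => x y /=; ring.
Qed.

Lemma cross_density_sym f g p : cross_density f g p = cross_density g f p.
Proof.
by rewrite /cross_density; case: (f _) => a b; case: (g _) => c d /=; congr (_ * _); ring.
Qed.

Lemma cross_densityZr (t : R) f g p :
  cross_density f (fun z => t%:C * g z) p = t * cross_density f g p.
Proof.
by rewrite /cross_density; case: (f _) => a b; case: (g _) => c d /=; ring.
Qed.

Lemma fockD f g : fock f -> fock g -> fock (fun z => f z + g z).
Proof.
move=> ff gg; have [[fe fi] [ge gi]] := (iffLR (fockP f) ff, iffLR (fockP g) gg).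
apply/fockP; split; first exact: (entireD fe ge).
have fg := integrable_cross_density ff gg; have gf := integrable_cross_density gg ff.
rewrite (_ : EFin \o _ = ((EFin \o cross_density f f) \+ (EFin \o cross_density f g)) \+
  ((EFin \o cross_density g f) \+ (EFin \o cross_density g g)))%E.
  by apply: integrableD => //; apply: integrableD.
apply/funext => p /=; rewrite -!EFinD; congr _%:E.
rewrite !cross_densityDr (cross_density_sym _ f) (cross_density_sym _ g).
by rewrite !cross_densityDr.
Qed.

Lemma fockB f g : fock f -> fock g -> fock (fun z => f z - g z).
Proof.
move=> ff gg; rewrite (_ : (fun _ => _) = fun z => f z + -1 * g z).
  by apply: fockD => //; exact: fock_scale.
by apply/funext => z; rewrite mulN1r.
Qed.

Lemma re_dotDr f g h : fock f -> fock g -> fock h ->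
  re_dot f (fun z => g z + h z) = re_dot f g + re_dot f h.
Proof.
move=> ff gg hh; rewrite /re_dot -mulrDr -RintegralD //; last 2 first.
- exact: integrable_cross_density.
- exact: integrable_cross_density.
by congr (_ * _); apply: eq_Rintegral => p _; exact: cross_densityDr.
Qed.

Lemma re_dotC f g : re_dot f g = re_dot g f.
Proof.
by rewrite /re_dot; congr (_ * _); apply: eq_Rintegral => p _; exact: cross_density_sym.
Qed.

Lemma re_dotZr (t : R) f g : fock f -> fock g ->
  re_dot f (fun z => t%:C * g z) = t * re_dot f g.
Proof.
move=> ff gg; rewrite /re_dot mulrCA; congr (_ * _).
rewrite -RintegralZl //; last exact: integrable_cross_density.
by apply: eq_Rintegral => p _; exact: cross_densityZr.
Qed.

Lemma re_dot_sqD f g : fock f -> fock g ->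
  re_dot (fun z => f z + g z) (fun z => f z + g z) =
  re_dot f f + 2 * re_dot f g + re_dot g g.
Proof.
move=> ff gg; rewrite re_dotDr //; last exact: fockD.
rewrite re_dotC re_dotDr // [X in _ + X]re_dotC re_dotDr // (re_dotC g f); ring.
Qed.

Lemma fock_cst0 : fock (fun=> 0 : R[i]).
Proof.
apply/fockP; split; first exact: entire_cst.
rewrite (_ : EFin \o _ = cst 0%E); first exact: integrable0.
by apply/funext => p; rewrite [LHS]/comp /cross_density mul0r [complex.Re 0]/= mul0r.
Qed.

Lemma fock_sum (I : Type) (r : seq I) (F : I -> R[i] -> R[i]) :
  (forall i, fock (F i)) -> fock (fun z => \sum_(i <- r) F i z).
Proof.
move=> Ff; elim: r => [|i r IH].
  rewrite (_ : (fun _ => _) = fun=> 0); first exact: fock_cst0.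
  by apply/funext => z; rewrite big_nil.
rewrite (_ : (fun _ => _) = fun z => F i z + \sum_(j <- r) F j z).
  exact: (fockD (Ff i) IH).
by apply/funext => z; rewrite big_cons.
Qed.

Lemma re_dot_sumr (I : Type) (r : seq I) (F : I -> R[i] -> R[i]) f :
  fock f -> (forall i, fock (F i)) ->
  re_dot f (fun z => \sum_(i <- r) F i z) = \sum_(i <- r) re_dot f (F i).
Proof.
move=> ff Ff; elim: r => [|i r IH].
  rewrite big_nil (_ : (fun _ => _) = fun z => 0%:C * 0).
    by rewrite (re_dotZr 0 ff fock_cst0) mul0r.
  by apply/funext => z; rewrite big_nil mulr0.
rewrite big_cons -IH -re_dotDr //; last exact: fock_sum.
by congr re_dot; apply/funext => z; rewrite big_cons.
Qed.

(** Polynomials and kernels have exponential growth, a property stable under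
    sums and products; it is a convenient criterion for membership in the Fock
    space ([exp_growth_fock]). *)
Definition exp_growth f := exists C c : R,
  [/\ 0 <= C & forall z, normc (f z) <= C * expR (c * normc z)].

(** Up to a factor, the product of two standard normal densities. *)
Lemma integrable_half_gauss :
  mu2.-integrable setT (fun p => (expR (- (p.1 ^+ 2 + p.2 ^+ 2) / 2))%:E).
Proof.
have n1 : (1 : R) != 0 by rewrite oner_eq0.
have k0 := normal_peak_gt0 n1.
pose q (p : R * R) := normal_pdf 0 1 p.1 * normal_pdf 0 1 p.2.
have qE p : expR (- (p.1 ^+ 2 + p.2 ^+ 2) / 2) = (@normal_peak R 1 ^- 2) * q p.
  rewrite /q normal_pdfE // /normal_fun !subr0 expr1n.
  have -> : - (p.1 ^+ 2 + p.2 ^+ 2) / 2 = - p.1 ^+ 2 / (1 *+ 2) + - p.2 ^+ 2 / (1 *+ 2).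
    by rewrite opprD mulrDl.
  rewrite expRD; field; exact: lt0r_neq0.
have mq : measurable_fun setT q.
  by apply: measurable_funM; apply: measurableT_comp => //; exact: measurable_normal_pdf.
have q0 p : 0 <= q p by rewrite mulr_ge0 // normal_pdf_ge0.
have iq : mu2.-integrable setT (EFin \o q).
  apply/integrableP; split; first exact/measurable_EFinP.
  under eq_integral do rewrite /= ger0_norm //.
  rewrite plane_tonelli_xy; [|exact/measurable_EFinP|by move=> p; rewrite lee_fin].
  have mp : measurable_fun setT (EFin \o @normal_pdf R 0 1).
    by apply/measurable_EFinP; exact: measurable_normal_pdf.
  have -> : (\int[mu]_x \int[mu]_y (q (x, y))%:E = \int[mu]_x (normal_pdf 0 1 x)%:E)%E.
    apply: eq_integral => x _; under eq_integral do rewrite /q /= EFinM.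
    rewrite ge0_integralZl // ?lee_fin ?normal_pdf_ge0 //.
      by rewrite integral_normal_pdf mule1.
    by move=> y _; rewrite lee_fin normal_pdf_ge0.
  by rewrite integral_normal_pdf ltry.
rewrite (_ : (fun _ => _) = fun p => ((@normal_peak R 1 ^- 2)%:E * (EFin \o q) p)%E).
  exact: integrableZl.
by apply/funext => p; rewrite qE EFinM.
Qed.

(** From [2 c r <= 2 c ^ 2 + r ^ 2 / 2] with [r = |z|], the density
    [|f|^2 exp(- r ^ 2)] is dominated by a multiple of [exp(- r ^ 2 / 2)]. *)
Lemma exp_growth_fock f : entire f -> exp_growth f -> fock f.
Proof.
move=> fe [C [c [C0 fC]]]; apply/fockP; split=> //.
apply: (@le_integrable _ _ _ mu2 _ measurableT _ (fun p =>
  ((C ^+ 2 * expR (2 * c ^+ 2))%:E * (expR (- (p.1 ^+ 2 + p.2 ^+ 2) / 2))%:E)%E)).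
- by apply/measurable_EFinP; exact: measurable_cross_density.
- move=> p _; rewrite /= lee_fin ger0_norm ?cross_density_ge0 //.
  rewrite ger0_norm; last by rewrite !mulr_ge0 ?sqr_ge0 ?expR_ge0.
  rewrite cross_density_normc; set z := p.1 +i* p.2.
  have zp : p.1 ^+ 2 + p.2 ^+ 2 = normc z ^+ 2 by rewrite normc_sqr.
  rewrite /gauss2 zp -[leRHS]mulrA -expRD.
  apply: (@le_trans _ _ ((C * expR (c * normc z)) ^+ 2 * expR (- normc z ^+ 2))).
    rewrite ler_pM2r ?expR_gt0 // ler_pXn2r ?nnegrE ?normc_ge0 //.
    by rewrite mulr_ge0 ?expR_ge0.
  rewrite exprMn -[leLHS]mulrA -expRM_natl -expRD; apply: ler_wpM2l; first exact: sqr_ge0.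
  rewrite ler_expR; have := sqr_ge0 (2 * c - normc z); nra.
- by apply: integrableZl => //; exact: integrable_half_gauss.
Qed.

Lemma exp_growthD f g : exp_growth f -> exp_growth g -> exp_growth (fun z => f z + g z).
Proof.
move=> [C [c [C0 fC]]] [D [d [D0 gD]]]; exists (C + D), (Num.max c d); split.
  exact: addr_ge0.
move=> z; apply: le_trans (le_normcD _ _) _; rewrite mulrDl; apply: lerD.
  apply: le_trans (fC z) _; apply: ler_wpM2l => //; rewrite ler_expR.
  by rewrite ler_wpM2r ?normc_ge0 // le_max lexx.
apply: le_trans (gD z) _; apply: ler_wpM2l => //; rewrite ler_expR.
by rewrite ler_wpM2r ?normc_ge0 // le_max lexx orbT.
Qed.

Lemma exp_growthM f g : exp_growth f -> exp_growth g -> exp_growth (fun z => f z * g z).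
Proof.
move=> [C [c [C0 fC]]] [D [d [D0 gD]]]; exists (C * D), (c + d); split.
  exact: mulr_ge0.
move=> z; rewrite normcM mulrDl expRD mulrACA.
by apply: ler_pM => //; exact: normc_ge0.
Qed.

Lemma exp_growth_cst (c : R[i]) : exp_growth (fun=> c).
Proof.
by exists (normc c), 0; split=> [|z]; rewrite ?normc_ge0 // mul0r expR0 mulr1.
Qed.

Lemma exp_growth_id : exp_growth (fun z => z).
Proof.
exists 1, 1; split=> // z; rewrite !mul1r.
by apply: le_trans (expR_ge1Dx _); rewrite lerDr.
Qed.

Lemma exp_growth_expC (w : R[i]) : exp_growth (fun z => expC (z * w)).
Proof.
exists 1, (normc w); split=> // z; rewrite mul1r normc_expC ler_expR.
apply: le_trans (ler_norm _) _; apply: le_trans (normr_Re_le _) _.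
by rewrite normcM mulrC.
Qed.

Lemma exp_growth_prod (I : Type) (r : seq I) (P : pred I) (F : I -> R[i] -> R[i]) :
  (forall i, exp_growth (F i)) -> exp_growth (fun z => \prod_(i <- r | P i) F i z).
Proof.
move=> Fe; elim: r => [|i r IH].
  rewrite (_ : (fun _ => _) = fun=> 1); first exact: exp_growth_cst.
  by apply/funext => z; rewrite big_nil.
have [Pi|Pi] := boolP (P i).
  rewrite (_ : (fun _ => _) = fun z => F i z * \prod_(j <- r | P j) F j z).
    exact: (exp_growthM (Fe i) IH).
  by apply/funext => z; rewrite big_cons Pi.
rewrite (_ : (fun _ => _) = fun z => \prod_(j <- r | P j) F j z); first exact: IH.
by apply/funext => z; rewrite big_cons (negbTE Pi).
Qed.

End fock_space.

(** * The reproducing property *)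

Section reproducing.
Variable R : realType.
Notation mu := (@lebesgue_measure R).
Notation mu2 := (mu \x mu)%E.
Implicit Types f g h : R[i] -> R[i].

Definition kernel (w z : R[i]) : R[i] := expC (z * w^*%C).

Lemma fock_kernel w : fock (kernel w).
Proof.
apply: exp_growth_fock; last exact: exp_growth_expC.
exact: (entire_comp entire_expC (entireM entire_id (entire_cst _))).
Qed.

Lemma expC_conj (z : R[i]) : (expC z)^*%C = expC z^*%C.
Proof. by case: z => x y; rewrite /expC /= cosN sinN mulrN. Qed.

Lemma gauss2_expC (p : R * R) :
  (gauss2 p)%:C = expC (- ((p.1 +i* p.2) * (p.1 +i* p.2)^*%C)).
Proof.
rewrite /expC /= [X in cos X](_ : _ = 0); last by ring.
rewrite [X in sin X](_ : _ = 0); last by ring.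
rewrite cos0 sin0 mulr1 mulr0; congr ((expR _)%:C); ring.
Qed.

Lemma Re_mulr_real (z : R[i]) (r : R) : complex.Re z * r = complex.Re (z * r%:C).
Proof. by case: z => x y /=; rewrite mulr0 subr0. Qed.

(** Completing the square: around [w] the weighted product with the kernel is the
    weighted value at the origin of an entire function. *)
Lemma cross_density_kernel f (w : R[i]) (p : R * R) :
  cross_density f (kernel w) (p.1 + complex.Re w, p.2 + complex.Im w) =
  complex.Re (f (w + (p.1 +i* p.2)) * expC (- w^*%C * (p.1 +i* p.2))) * gauss2 p.
Proof.
rewrite /cross_density !Re_mulr_real !gauss2_expC /kernel expC_conj.
have -> : (p.1 + complex.Re w, p.2 + complex.Im w).1 +i*
    (p.1 + complex.Re w, p.2 + complex.Im w).2 = w + (p.1 +i* p.2).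
  by case: w => a b /=; congr (_ +i* _); rewrite addrC.
move: (p.1 +i* p.2) => u.
rewrite -!mulrA -!expCD; congr (complex.Re (_ * expC _)).
by rewrite !rmorphM !rmorphD /= conjcK; ring.
Qed.

(** The translation by [w] turns the weighted product with the kernel into
    [Re g * gauss2] with [g] entire and [g 0 = f w]; integrability carries over
    because the translation also preserves the integral of absolute values. *)
Theorem reproducing f w : fock f -> re_dot f (kernel w) = complex.Re (f w).
Proof.
move=> ff; have fe : entire f by case: ff.
pose g u := f (w + u) * expC (- w^*%C * u).
have ge : entire g.
  apply: entireM.
    exact: (entire_comp fe (entireD (entire_cst w) entire_id)).
  exact: (entire_comp entire_expC (entireM (entire_cst (- w^*%C)) entire_id)).
have ik := integrable_cross_density ff (fock_kernel w).
have mk : measurable_fun setT (cross_density f (kernel w)).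
  by apply/measurable_EFinP; case/integrableP: ik.
have T := plane_preserving_translation (complex.Re w) (complex.Im w).
have mg : measurable_fun setT (fun p : R * R => complex.Re (g (p.1 +i* p.2)) * gauss2 p).
  by apply: measurable_funM; [exact: entire_measurable_Re|exact: measurable_gauss2].
have tr (F : R -> R) : measurable_fun setT F ->
    (\int[mu2]_p (F (complex.Re (g (p.1 +i* p.2)) * gauss2 p))%:E =
     \int[mu2]_p (F (cross_density f (kernel w) p))%:E)%E.
  move=> mF.
  rewrite -(plane_preserving_integral T (f := fun p => (F (cross_density f (kernel w) p))%:E)).
    by apply: eq_integral => p _; rewrite cross_density_kernel.
  by apply/measurable_EFinP; exact: (measurableT_comp mF mk).
have ig : mu2.-integrable setT (fun p => (complex.Re (g (p.1 +i* p.2)) * gauss2 p)%:E).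
  apply/integrableP; split; first exact/measurable_EFinP.
  have -> : (\int[mu2]_p `|(complex.Re (g (p.1 +i* p.2)) * gauss2 p)%:E| =
     \int[mu2]_p `|(cross_density f (kernel w) p)%:E|)%E by exact: (tr (fun x => `|x|)).
  by case/integrableP: ik.
have := gaussian_mean_value ge ig; rewrite (tr id) //.
rewrite /re_dot /Rintegral => -> /=.
by rewrite mulrCA mulVf ?gt_eqF ?pi_gt0 // mulr1 /g addr0 mulr0 expC0 mulr1.
Qed.

(** At [t = - B / (|A| + 1)] the linear term would dominate if [B] were not 0. *)
Lemma affine_quadratic_ge0 (A B : R) :
  (forall t, 0 <= t ^+ 2 * A + t * B) -> B = 0.
Proof.
move=> H; apply/eqP/negPn/negP => B0.
have A1 : 0 < `|A| + 1 by rewrite ltr_wpDl.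
have B2 : 0 < B ^+ 2 by rewrite exprn_even_gt0.
have := H (- B / (`|A| + 1)).
have -> : (- B / (`|A| + 1)) ^+ 2 * A + - B / (`|A| + 1) * B =
    B ^+ 2 * (A - (`|A| + 1)) / (`|A| + 1) ^+ 2 by field; exact: lt0r_neq0.
rewrite leNgt => /negP; apply.
rewrite pmulr_llt0 ?invr_gt0 ?exprn_gt0 // pmulr_rlt0 //.
have := ler_norm A; lra.
Qed.

Lemma re_dot_sqDZ (t : R) f g : fock f -> fock g ->
  re_dot (fun z => f z + t%:C * g z) (fun z => f z + t%:C * g z) =
  re_dot f f + t * (2 * re_dot f g) + t ^+ 2 * re_dot g g.
Proof.
move=> ff gg; have tg := fock_scale t%:C gg.
rewrite re_dot_sqD // !re_dotZr // (re_dotC (fun z => t%:C * g z) g) re_dotZr //; ring.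
Qed.

(** If [h] has norm 0, then [||h + t B_z||^2 >= 0] for all real [t] forces the
    real inner product of [h] with the kernel [B_z], i.e. [Re (h z)], to vanish.
    The same for [- i h] gives the imaginary part. *)
Lemma re_dot_eq0 h : fock h -> re_dot h h = 0 -> forall z, h z = 0.
Proof.
have Re0 (k : R[i] -> R[i]) : fock k -> re_dot k k = 0 -> forall z, complex.Re (k z) = 0.
  move=> kk k0 z; rewrite -(reproducing z kk).
  suff : 2 * re_dot k (kernel z) = 0 by move/eqP; rewrite mulf_eq0 pnatr_eq0 => /eqP.
  apply: (@affine_quadratic_ge0 (re_dot (kernel z) (kernel z))) => t.
  have := re_dot_ge0 (fun u => k u + t%:C * kernel z u).
  by rewrite re_dot_sqDZ ?k0 ?add0r 1?addrC //; exact: fock_kernel.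
move=> hh h0 z; have ih := fock_scale (- 'i%C) hh.
have := Re0 _ hh h0 z; have := Re0 _ ih _ z.
rewrite Re_mulNi; case: (h z) => x y /= /(_ _) -> // => [->//|].
rewrite -[RHS]h0 /re_dot; congr (_ * _); apply: eq_Rintegral => p _.
by rewrite !cross_density_normc normcM normcN /= expr0n expr1n add0r sqrtr1 mul1r.
Qed.

End reproducing.

(** * The minimization problem *)

Section minimization.
Variables (R : realType) (n : nat).
Hypothesis n_gt0 : (1 <= n)%N.
Implicit Types f g h : R[i] -> R[i].

Definition abscissa (j : nat) : R := 1 - 2 * j%:R / n%:R.

Lemma node_conj j : (node R n j)^*%C = 'i%C * (abscissa j)%:C.
Proof. by rewrite /node /abscissa /=; congr (_ +i* _); ring. Qed.

Lemma node_inj : injective (node R n).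
Proof.
move=> j k /(congr1 (@complex.Im R)); rewrite /node /= => H.
have n0 : (n%:R : R) != 0 by rewrite pnatr_eq0 -lt0n.
have : 2 * j%:R / n%:R = 2 * k%:R / n%:R :> R by move: H; lra.
move/(mulIf (invr_neq0 n0))/mulfI => /(_ _)/eqP; rewrite eqr_nat => H2.
by apply/eqP/H2; rewrite pnatr_eq0.
Qed.

Lemma superosc_kernel (a : R) : superosc n a =
  (fun z => \sum_(j < n.+1) (coefF n a j)%:C * kernel (node R n j) z).
Proof.
apply/funext => z; apply: eq_bigr => j _.
by rewrite /kernel node_conj [z * _]mulrC.
Qed.

Lemma fock_superosc (a : R) : fock (superosc n a).
Proof.
by rewrite superosc_kernel; apply: fock_sum => j; apply: fock_scale; exact: fock_kernel.
Qed.

(** [superosc n a] is a real combination of the kernels at the nodes, so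
    pairing with it evaluates [h] at the nodes. *)
Lemma re_dot_superosc (a : R) h : fock h ->
  re_dot (superosc n a) h = \sum_(j < n.+1) coefF n a j * complex.Re (h (node R n j)).
Proof.
move=> hh; rewrite re_dotC superosc_kernel re_dot_sumr //; last first.
  by move=> j; apply: fock_scale; exact: fock_kernel.
by apply: eq_bigr => j _; rewrite re_dotZr ?reproducing //; exact: fock_kernel.
Qed.

(** The unnormalized Lagrange polynomials separate the values at the nodes. *)
Definition lagrange (k : 'I_n.+1) (z : R[i]) : R[i] :=
  \prod_(j < n.+1 | j != k) (z - node R n j).

Lemma fock_lagrange k : fock (lagrange k).
Proof.
apply: exp_growth_fock.
  by apply: entire_prod => j; exact: (entireD entire_id (entire_cst _)).
apply: exp_growth_prod => j.
by apply: exp_growthD; [exact: exp_growth_id|exact: exp_growth_cst].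
Qed.

Lemma lagrange_node (k j : 'I_n.+1) : j != k -> lagrange k (node R n j) = 0.
Proof. by move=> jk; rewrite /lagrange (bigD1 j) //= subrr mul0r. Qed.

Lemma lagrange_node_neq0 (k : 'I_n.+1) : lagrange k (node R n k) != 0.
Proof.
apply/prodf_neq0 => j jk; rewrite subr_eq0.
by apply: contra jk => /eqP/node_inj/val_inj ->.
Qed.

Variables (a lambda : R) (w : 'I_n.+1 -> R[i]).
Hypothesis lambda_gt0 : 0 < lambda.
Notation F := (superosc n a).
Notation J := (functional_J lambda w).

(** The coefficient of [h (node R n k)] in half the derivative of the functional at
    [F] in the direction [h]; see [real_J_expand]. *)
Definition defect (k : 'I_n.+1) : R[i] :=
  (lambda * coefF n a k)%:C - (w k - F (node R n k))^*%C.

Definition real_J f : R :=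
  \sum_(k < n.+1) normc (w k - f (node R n k)) ^+ 2 + lambda * re_dot f f.

Lemma functional_J_real f : fock f -> J f = (real_J f)%:E.
Proof. by move=> ff; rewrite /functional_J fock_sqnorm_re_dot // -EFinM -EFinD. Qed.

Lemma real_J_expand (t : R) h : fock h ->
  real_J (fun z => F z + t%:C * h z) = real_J F
  + t * (2 * \sum_(k < n.+1) complex.Re (h (node R n k) * defect k))
  + t ^+ 2 * (\sum_(k < n.+1) normc (h (node R n k)) ^+ 2 + lambda * re_dot h h).
Proof.
move=> hh; rewrite /real_J re_dot_sqDZ //; last exact: fock_superosc.
rewrite (re_dot_superosc a hh).
have E k : normc (w k - (F (node R n k) + t%:C * h (node R n k))) ^+ 2 =
    normc (w k - F (node R n k)) ^+ 2
    + t * (2 * (complex.Re (h (node R n k) * defect k)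
                - lambda * (coefF n a k * complex.Re (h (node R n k)))))
    + t ^+ 2 * normc (h (node R n k)) ^+ 2.
  rewrite /defect !normc_sqr.
  by case: (w k) (F _) (h _) => [x y] [u v] [c d] /=; ring.
under eq_bigr do rewrite E.
rewrite !big_split /= -!mulr_sumr sumrB -mulr_sumr.
move: (\sum_(k < n.+1) _) (\sum_(k < n.+1) _) (\sum_(k < n.+1) _) (\sum_(k < n.+1) _).
move=> S1 S2 S3 S4; ring.
Qed.

(** Minimality along the line [F + t h] makes the linear coefficient vanish.  For
    [h] the Lagrange polynomial of index [k], scaled by the conjugate of
    [lagrange k (node R n k) * defect k], this coefficient is twice the squared
    modulus of that product. *)
Lemma minimizer_defect : is_minimizer (@fock R) J F -> forall k, defect k = 0.
Proof.
move=> [Ff Fmin] k; set c := (lagrange k (node R n k) * defect k)^*%C.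
pose h z := c * lagrange k z.
have hh : fock h by apply: fock_scale; exact: fock_lagrange.
have /eqP : 2 * \sum_(j < n.+1) complex.Re (h (node R n j) * defect j) = 0.
  apply: (@affine_quadratic_ge0 R
    (\sum_(k < n.+1) normc (h (node R n k)) ^+ 2 + lambda * re_dot h h)) => t.
  have fth : fock (fun z => F z + t%:C * h z) by apply: fockD => //; exact: fock_scale.
  have := Fmin _ fth; rewrite !functional_J_real // lee_fin real_J_expand //.
  by rewrite -addrA lerDl addrC.
rewrite mulf_eq0 pnatr_eq0 /= (bigD1 k) //= big1 ?addr0; last first.
  by move=> j jk; rewrite /h lagrange_node // mulr0 mul0r.
have -> : complex.Re (h (node R n k) * defect k) =
    normc (lagrange k (node R n k) * defect k) ^+ 2.
  rewrite normc_sqr /h -mulrA /c.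
  by case: (_ * defect k) => x y /=; ring.
rewrite sqrf_eq0 => /eqP/eq0_normc/eqP.
by rewrite mulf_eq0 (negbTE (lagrange_node_neq0 k)) => /eqP.
Qed.

(** With zero derivative at [F], the functional exceeds its value at [F] by
    a nonnegative quadratic form in [f - F], which controls the Fock norm. *)
Lemma defect_minimizer : (forall k, defect k = 0) ->
  unique (is_minimizer (@fock R) J) F.
Proof.
move=> d0; have Ff := fock_superosc a.
have expand f : fock f -> real_J f = real_J F +
    (\sum_(k < n.+1) normc (f (node R n k) - F (node R n k)) ^+ 2
     + lambda * re_dot (fun z => f z - F z) (fun z => f z - F z)).
  move=> ff; have hh := fockB ff Ff.
  have := real_J_expand 1 hh.
  rewrite big1 ?mulr0 ?addr0 ?expr1n ?mul1r; last by move=> k _; rewrite d0 mulr0.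
  by move<-; congr real_J; apply/funext => z; rewrite mul1r addrC subrK.
have sum_ge0 f : 0 <= \sum_(k < n.+1) normc (f (node R n k) - F (node R n k)) ^+ 2.
  by apply: sumr_ge0 => k _; exact: sqr_ge0.
split=> [|f [ff fmin]].
  split=> // f ff; rewrite !functional_J_real // lee_fin (expand f) // lerDl.
  by rewrite addr_ge0 // mulr_ge0 ?re_dot_ge0 // ltW.
have := fmin _ Ff; rewrite !functional_J_real // lee_fin (expand f) //.
rewrite gerDl => H.
have hh := fockB ff Ff.
have h0 : re_dot (fun z => f z - F z) (fun z => f z - F z) = 0.
  apply/eqP; rewrite eq_le re_dot_ge0 andbT -(pmulr_rle0 _ lambda_gt0).
  by apply: le_trans H; rewrite lerDr.
apply/funext => z; apply/eqP; rewrite eq_sym -subr_eq0; apply/eqP.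
exact: (re_dot_eq0 hh h0 z).
Qed.

Lemma expC_real (x : R) : expC x%:C = (expR x)%:C.
Proof. by rewrite /expC /= cos0 sin0 mulr1 mulr0. Qed.

Lemma superosc_node (k : nat) : F (node R n k) =
  (\sum_(j < n.+1) coefF n a j * expR (abscissa j * abscissa k))%:C.
Proof.
rewrite /superosc rmorph_sum /=; apply: eq_bigr => j _.
transitivity ((coefF n a j)%:C * (expR (abscissa j * abscissa k))%:C); last first.
  by rewrite -rmorphM.
rewrite -expC_real; congr (_ * expC _).
by rewrite /node /abscissa /=; congr (_ +i* _); ring.
Qed.

Lemma coefF_factor j : 1 + a != 0 -> (j <= n)%N ->
  coefF n a j = ((1 + a) / 2) ^+ n * ('C(n, j)%:R * ((1 - a) / (1 + a)) ^+ j).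
Proof.
move=> a0 jn; rewrite /coefF.
have -> : (1 - a) / 2 = (1 + a) / 2 * ((1 - a) / (1 + a)) by field.
have -> : ((1 + a) / 2) ^+ n = ((1 + a) / 2) ^+ (n - j) * ((1 + a) / 2) ^+ j.
  by rewrite -exprD subnK.
rewrite [((1 + a) / 2 * _) ^+ j]exprMn.
move: (_ ^+ (n - j)) (_ ^+ j) (_ ^+ j) => x y z; ring.
Qed.

(** The exponent [abscissa j * abscissa k] is affine in [j], so the sum is a
    binomial expansion. *)
Lemma superosc_node_closed (k : nat) : 1 + a != 0 -> F (node R n k) =
  (((1 + a) / 2) ^+ n * (expR (1 - 2 * k%:R / n%:R) *
     (1 + (1 - a) / (1 + a) * expR (- (2 / n%:R) + 4 * k%:R / n%:R ^+ 2)) ^+ n))%:C.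
Proof.
move=> a0; rewrite superosc_node; congr (_%:C).
rewrite exprDn !mulr_sumr; apply: eq_bigr => j _.
have jn : (j <= n)%N by rewrite -ltnS.
rewrite coefF_factor // expr1n mul1r [(_ * expR _) ^+ _]exprMn -expRM_natl -[_ *+ 'C(n, j)]mulr_natl.
rewrite [expR (abscissa j * _)](_ : _ = expR (1 - 2 * k%:R / n%:R) *
    expR (j%:R * (- (2 / n%:R) + 4 * k%:R / n%:R ^+ 2))); first by ring.
rewrite -expRD; congr expR; rewrite /abscissa; field.
by rewrite pnatr_eq0 -lt0n.
Qed.

Lemma defect_eq0 (k : 'I_n.+1) : 1 + a != 0 -> defect k = 0 <->
  w k = (((1 + a) / 2) ^+ n *
     (expR (1 - 2 * k%:R / n%:R) *
        (1 + (1 - a) / (1 + a) * expR (- (2 / n%:R) + 4 * k%:R / n%:R ^+ 2)) ^+ n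
      + lambda * 'C(n, k)%:R * ((1 - a) / (1 + a)) ^+ k))%:C.
Proof.
move=> a0; have kn : (k <= n)%N by rewrite -ltnS.
set v := (_ * (_ + _)); have -> : v%:C = F (node R n k) + (lambda * coefF n a k)%:C.
  rewrite superosc_node_closed // coefF_factor // -rmorphD /v; congr (_%:C).
  by rewrite mulrDr; congr (_ + _); rewrite -[lambda * _ * _]mulrA mulrCA.
rewrite /defect; split=> [/eqP|->].
  rewrite subr_eq0 => /eqP/(congr1 conjc); rewrite conjcK conjc_real => ->.
  by rewrite addrC subrK.
by rewrite (addrC (F _)) addrK conjc_real subrr.
Qed.

End minimization.

Theorem theorem4p4 (R : realType) (n : nat) (a lambda : R)
    (w : 'I_n.+1 -> R[i]) (hn : (1 <= n)%N) (ha : 1 < a) (hlambda : 0 < lambda) :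
  unique (is_minimizer (@fock R) (functional_J lambda w)) (superosc n a) <->
  (forall k : 'I_n.+1,
     w k = (((1 + a) / 2) ^+ n *
            (expR (1 - 2 * k%:R / n%:R) *
             (1 + (1 - a) / (1 + a)
                  * expR (- (2 / n%:R) + 4 * k%:R / n%:R ^+ 2)) ^+ n
             + lambda * 'C(n, k)%:R * ((1 - a) / (1 + a)) ^+ k))%:C).
Proof.
have a0 : 1 + a != 0 by rewrite gt_eqF //; lra.
split=> [[Fmin _] k|wE].
  by apply/(defect_eq0 hn) => //; exact: minimizer_defect.
by apply: defect_minimizer => // k; apply/(defect_eq0 hn).
Qed.
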